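(* Let $C>\sqrt{3/2}$ be a fixed constant, and let $p=p(n)$ satisfy $p> C\sqrt{\log n/n}$. Let $G=G_{n,p}$. Then with high probability $\mathcal{T}(G)=\mathcal{C}(G)$, i.e. the triangles of $G$ span the cycle space of $G$ over $\mathbb{Z}/2$.
   Context: $G_{n,p}$ is the binomial random graph on vertex set $[n]=\{1,\dots,n\}$ in which each of the $\binom n2$ possible edges is present independently with probability $p$. An event holds with high probability (w.h.p.) if its probability tends to $1$ as $n\to\infty$. $\log$ denotes the natural logarithm. For a graph $G$, the edge space $\mathcal{E}(G)=(\mathbb{Z}/2)^{E(G)}$ is identified with the set of subgraphs (edge subsets) of $G$, with addition being symmetric difference. The cycle space $\mathcal{C}(G)$ is the subspace of $\mathcal{E}(G)$ spanned by (edge sets of) cycles of $G$, and the triangle space $\mathcal{T}(G)$ is the subspace of $\mathcal{C}(G)$ spanned by the triangles of $G$. *)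

(* Defs.v *)
From HB Require Import structures.
From mathcomp Require Import all_boot all_order all_algebra.
From mathcomp Require Import all_classical all_reals all_analysis.
Set Implicit Arguments. Unset Strict Implicit. Unset Printing Implicit Defensive.
Import Order.TTheory GRing.Theory Num.Theory.

(* Vertices: 'I_n.  An edge is a 2-element subset of 'I_n; a (sub)graph /
   element of the edge space is a set of edges {set {set 'I_n}}. *)
Definition edge_set (n : nat) : {set {set 'I_n}} :=
  [set A : {set 'I_n} | #|A| == 2].

(* Sum in the edge space (Z/2)^E of a family of edge sets:
   an edge is in the sum iff it lies in an odd number of members. *)
Definition esum n (F : {set {set {set 'I_n}}}) : {set {set 'I_n}} :=
  [set e | odd #|[set S in F | e \in S]|].

Definition in_span n (F : {set {set {set 'I_n}}}) (S : {set {set 'I_n}}) : bool :=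
  [exists sub : {set {set {set 'I_n}}}, (sub \subset F) && (esum sub == S)].

Definition cyc_edges n (s : seq 'I_n) : {set {set 'I_n}} :=
  [set [set x; next s x] | x in s].

Definition cycles_of_len n (G : {set {set 'I_n}}) (P : nat -> bool)
  : {set {set {set 'I_n}}} :=
  [set S : {set {set 'I_n}} | [exists k : 'I_n.+1, exists t : k.-tuple 'I_n,
      [&& 3 <= k, P k, uniq t, S == cyc_edges t & S \subset G]]].

Definition cycles n (G : {set {set 'I_n}}) := cycles_of_len G (fun _ => true).
Definition triangles n (G : {set {set 'I_n}}) := cycles_of_len G (fun k => k == 3).

Definition triangle_space_eq_cycle_space n (G : {set {set 'I_n}}) : bool :=
  [forall S : {set {set 'I_n}}, in_span (triangles G) S == in_span (cycles G) S].

Local Open Scope ring_scope.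

Definition Gnp_prob {R : realType} (n : nat) (p : R) (P : pred {set {set 'I_n}}) : R :=
  \sum_(G : {set {set 'I_n}} | (G \subset edge_set n) && P G)
     p ^+ #|G| * (1 - p) ^+ (#|edge_set n| - #|G|).

(* Main.v *)
(** A set F of edges of G meeting every triangle evenly is called a cocycle; by duality over
    Z/2, the triangles span the cycle space iff every cocycle is a cut of G.

    Far from cuts: expose first the edges touching a small linear set W of vertices, and take a
    union bound over the labels that F may give them.  Almost every pair x, y outside W has a
    common neighbour in W, and then F is forced on x y if this is an edge.  Unless the forced
    values are close to a cut, many pairs are incompatible with the edges seen so far, and the
    probability that all of them are non-edges beats the union bound.  So with high probability
    each cocycle agrees with a cut up to g n^2 p edges, for a constant g as small as needed.

    Close to cuts: let A_v be the F-neighbourhood of v for an F of minimum size in its class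
    modulo cuts.  Counting the triangles that meet F at each of their vertices gives
    sum_{vx in F} codeg(v, x) = 2 sum_v e(A_v).  When C > sqrt (3/2) every edge lies in at
    least eta n p^2 triangles, whereas e(A_v) is much smaller than |A_v| n p^2 when |A_v| is
    small; so the vertices with large A_v carry a constant proportion of F.  As F is small they
    are few and span few edges, and the expansion of their neighbourhoods produces too many
    triangles meeting F twice, unless F is empty. *)

(* The constant sqrt (3/2) is the threshold for edges lying in no triangle: at p = C sqrt (log n /
   n) about n^2 p exp (- n p^2) of them are expected, and the factor p is worth n^(-1/2) up to
   logarithms, so this tends to 0 beyond C^2 = 3/2. The other estimates have room to spare.

   A union bound over all cocycles fails: there may be exp (c n^2 p) labellings, and failure
   probabilities are of the same order. Labels are therefore enumerated only on the edges at W,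
   where |W| is about ep n; their number exp (O(ep n^2 p)) is beaten by a rate that does not depend
   on ep, so ep is chosen last.

   A second set X, of about xi n pivots, supplies the cut: a pivot x puts y on the side given by the
   label forced on x y. If this fails for the pivots, there are many triples x, y, z with odd forced
   sum; the edges at X, exposed next, contain both x y and x z for many of them, and then all these
   y z have to be non-edges.

   Since p has no upper bound below 1, everything is measured by d = n p and q = n p^2. The
   constants come in the order eta, tau1, theta, tau2, sigma, and then g = theta sigma. *)
Require Import Defs.
From mathcomp Require Import all_boot all_order all_algebra.
From mathcomp Require Import all_classical all_reals all_analysis.
From mathcomp Require Import ring lra zify fintype finset.
Set Implicit Arguments. Unset Strict Implicit. Unset Printing Implicit Defensive.
Import Order.TTheory GRing.Theory Num.Theory.
Import numFieldNormedType.Exports.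
Local Open Scope ring_scope.

(** * Random subsets of a finite set *)

Section RandomSubset.
Variables (R : realType) (T : finType) (p : R).
Implicit Types (E A B S G : {set T}) (f g : {set T} -> R) (P Q : pred {set T}).

(** Expectation under the product Bernoulli measure, as a finite sum. The ground set is an argument
    so that exposing edges in stages becomes an iterated [Ex]. *)
Definition Ex E f : R :=
  \sum_(G : {set T} | G \subset E) p ^+ #|G| * (1 - p) ^+ (#|E| - #|G|) * f G.

Definition Pr E P : R := Ex E (fun G => (P G)%:R).

Lemma Ex0 f : Ex set0 f = f set0.
Proof.
rewrite /Ex (big_pred1 set0) => [|G]; last by rewrite subset0.
by rewrite cards0 subnn !expr0 !mul1r.
Qed.

Lemma ExU1 e E f : e \notin E ->
  Ex (e |: E) f = p * Ex E (fun G => f (e |: G)) + (1 - p) * Ex E f.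
Proof.
move=> eE; rewrite /Ex (bigID (fun G : {set T} => e \in G)) /=; congr (_ + _).
  rewrite mulr_sumr (reindex_onto (fun G => e |: G) (fun G => G :\ e)) /=; last first.
    by move=> G /andP[_ eG]; rewrite setD1K.
  apply: eq_big => [G|G].
    rewrite setU11 andbT; apply/andP/idP => [[sG /eqP <-]|sG].
      by rewrite subDset.
    split; first by rewrite setUS.
    apply/eqP; rewrite setU1K //; apply: contra eE; exact: (subsetP sG).
  move=> /andP[/andP[sG _] /eqP eG].
  have enG : e \notin G by rewrite -eG setD11.
  by rewrite !cardsU1 enG eE !add1n subSS exprS !mulrA.
rewrite mulr_sumr; apply: eq_big => [G|G].
  apply/andP/idP => [[sG eG]|sG].
    by rewrite -(setU1K eE) subsetD1 sG eG.
  split; first by rewrite subsetU ?sG ?orbT.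
  by apply: contra eE; exact: (subsetP sG).
move=> /andP[sG eG].
have sGE : G \subset E by rewrite -(setU1K eE) subsetD1 sG eG.
by rewrite cardsU1 eE add1n subSn ?subset_leq_card // exprS !mulrA [p ^+ _ * _]mulrC.
Qed.

Lemma eq_Ex E f g : (forall G, G \subset E -> f G = g G) -> Ex E f = Ex E g.
Proof. by move=> fg; apply: eq_bigr => G /fg ->. Qed.

Lemma ExD E f g : Ex E (fun G => f G + g G) = Ex E f + Ex E g.
Proof. by rewrite -big_split /=; apply: eq_bigr => G _; rewrite mulrDr. Qed.

Lemma ExZ E c f : Ex E (fun G => c * f G) = c * Ex E f.
Proof. by rewrite mulr_sumr; apply: eq_bigr => G _; rewrite mulrCA. Qed.

Lemma Ex_sum (I : finType) (J : pred I) E (F : I -> {set T} -> R) :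
  Ex E (fun G => \sum_(i | J i) F i G) = \sum_(i | J i) Ex E (F i).
Proof. by rewrite exchange_big /=; apply: eq_bigr => G _; rewrite mulr_sumr. Qed.

Lemma set_ind_card (K : {set T} -> Prop) :
  K set0 -> (forall e A, e \notin A -> K A -> K (e |: A)) -> forall A, K A.
Proof.
move=> K0 KS A; have [m] := ubnP #|A|; elim: m A => // m IH A.
have [->//|/set0Pn[e eA]] := eqVneq A set0.
rewrite -(setD1K eA) cardsU1 setD11 add1n ltnS => cA.
by apply: KS; [rewrite setD11 | apply: IH].
Qed.

(** Fubini for the product measure, and the form in which independence is used: each exposure
    argument splits the edge set and bounds the inner expectation for every fixed outer value. *)
Lemma ExU A B f : [disjoint A & B] ->
  Ex (A :|: B) f = Ex A (fun G1 => Ex B (fun G2 => f (G1 :|: G2))).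
Proof.
elim/set_ind_card: A f => [|e A eA IH] f dAB.
  by rewrite Ex0 set0U; apply: eq_Ex => G _; rewrite set0U.
have eB : e \notin B.
  by apply: contraTN dAB => eB; apply/pred0Pn; exists e; rewrite /= setU11.
have dAB' : [disjoint A & B] by apply: disjointWl dAB; exact: subsetUr.
rewrite -setUA !ExU1 ?inE ?negb_or ?eA // !IH //.
congr (_ * _ + _); apply: eq_Ex => G1 _; apply: eq_Ex => G2 _.
by rewrite setUA.
Qed.

Lemma Ex_const E c : Ex E (fun=> c) = c.
Proof.
elim/set_ind_card: E => [|e A eA IH]; first by rewrite Ex0.
by rewrite ExU1 // IH -mulrDl addrC subrK mul1r.
Qed.

Lemma Ex_prod E (a b : T -> R) :
  Ex E (fun G => \prod_(e in E) (if e \in G then a e else b e)) =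
  \prod_(e in E) (p * a e + (1 - p) * b e).
Proof.
elim/set_ind_card: E => [|e A eA IH]; first by rewrite Ex0 !big_set0.
rewrite ExU1 // big_setU1 //= -IH.
set L := (X in _ = _ * X); rewrite (_ : _ * L = p * (a e * L) + (1 - p) * (b e * L)); last by ring.
congr (p * _ + _ * _); rewrite -ExZ; apply: eq_Ex => G sG; rewrite big_setU1 //=.
  rewrite setU11; congr (_ * _); apply: eq_bigr => i iA.
  by rewrite !inE; case: eqP => // ie; move: eA; rewrite -ie iA.
by rewrite (negbTE (contra (subsetP sG e) eA)).
Qed.

(** The generating function of a binomial variable factors over the elements of [S]; Chernoff bounds
    and codegree estimates are read off from it. *)
Lemma Ex_pow E S c : S \subset E ->
  Ex E (fun G => c ^+ #|G :&: S|) = (1 - p + p * c) ^+ #|S|.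
Proof.
move=> sS; have := Ex_prod E (fun e => if e \in S then c else 1) (fun=> 1).
set l := Ex _ _; set r := \prod_(_ in _) _ => lr.
transitivity l; first apply: eq_Ex => G sG.
  rewrite (eq_bigr (fun e => if e \in G :&: S then c else 1)); last first.
    by move=> e _; rewrite inE; do 2 case: (_ \in _).
  rewrite -big_mkcondr /= (eq_bigl (mem (G :&: S))) ?prodr_const //.
  by move=> e; rewrite !inE andbCA; case: (boolP (e \in G)) => // /(subsetP sG) ->.
rewrite lr /r (eq_bigr (fun e => if e \in S then 1 - p + p * c else 1)).
  rewrite -big_mkcondr /= (eq_bigl (mem S)) ?prodr_const //.
  by move=> e; rewrite andb_idl // => /(subsetP sS).
by move=> e _; case: ifP => _; ring.
Qed.

Lemma Ex_restr E S f : S \subset E -> Ex E (fun G => f (G :&: S)) = Ex S f.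
Proof.
move=> sS; rewrite -{1}(setID E S) (setIidPr sS) ExU; last first.
  by rewrite disjoints_subset; apply/fintype.subsetP => e eS; rewrite !inE eS.
apply: eq_Ex => G sG.
rewrite -[RHS](Ex_const (E :\: S)); apply: eq_Ex => G2 sG2; congr f.
rewrite setIUl (setIidPl sG); apply/setUidPl/subsetP => e; rewrite inE.
by case/andP=> /(subsetP sG2); rewrite inE => /andP[/negbTE->].
Qed.

Hypothesis p01 : 0 <= p <= 1.

Let w_ge0 E G : 0 <= p ^+ #|G| * (1 - p) ^+ (#|E| - #|G|).
Proof. by case/andP: p01 => p0 p1; rewrite mulr_ge0 // exprn_ge0 // subr_ge0. Qed.

Lemma le_Ex E f g : (forall G, G \subset E -> f G <= g G) -> Ex E f <= Ex E g.
Proof. by move=> fg; apply: ler_sum => G sG; rewrite ler_wpM2l ?w_ge0 ?fg. Qed.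

Lemma Ex_ge0 E f : (forall G, G \subset E -> 0 <= f G) -> 0 <= Ex E f.
Proof. by move=> f0; rewrite -[leLHS](Ex_const E 0) le_Ex. Qed.

Lemma Ex_le E f c : (forall G, G \subset E -> f G <= c) -> Ex E f <= c.
Proof. by move=> f0; rewrite -[leRHS](Ex_const E c) le_Ex. Qed.

Lemma Pr_ge0 E P : 0 <= Pr E P.
Proof. exact: Ex_ge0. Qed.

Lemma Pr_mono E P Q : (forall G, G \subset E -> P G -> Q G) -> Pr E P <= Pr E Q.
Proof.
move=> PQ; apply: le_Ex => G sG; case PG: (P G); last exact: ler0n.
by rewrite (PQ G sG PG).
Qed.

Lemma PrC E P : Pr E P = 1 - Pr E (predC P).
Proof.
apply/eqP; rewrite eq_sym subr_eq -ExD -[eqbLHS](Ex_const E 1); apply/eqP/eq_Ex => G _ /=.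
by rewrite -natrD; case: (P G).
Qed.

Lemma PrU E P Q : Pr E (fun G => P G || Q G) <= Pr E P + Pr E Q.
Proof.
rewrite -ExD; apply: le_Ex => G _.
by rewrite -natrD ler_nat; case: (P G).
Qed.

Lemma Pr_exists (I : finType) (J : pred I) E (F : I -> pred {set T}) :
  Pr E (fun G => [exists i, J i && F i G]) <= \sum_(i | J i) Pr E (F i).
Proof.
rewrite -Ex_sum; apply: le_Ex => G _.
case: existsP => [[i /andP[Ji Fi]]|_]; last by rewrite sumr_ge0.
by rewrite (bigD1 i) //= Fi lerDl sumr_ge0.
Qed.

Lemma Pr_exists_le (I : finType) (J : pred I) E (F : I -> pred {set T}) (c : R) :
  (forall i, J i -> Pr E (F i) <= c) ->
  Pr E (fun G => [exists i, J i && F i G]) <= #|J|%:R * c.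
Proof.
move=> Fc; apply: (le_trans (Pr_exists _ _ _)).
rewrite mulr_natl -sumr_const; exact: ler_sum.
Qed.

Lemma expX_ge (x : R) m : -1 <= x -> (1 + x) ^+ m <= expR (m%:R * x).
Proof.
move=> x1; rewrite mulrC expRM_natr lerXn2r ?nnegrE ?expR_ge0 ?expR_ge1Dx //.
by lra.
Qed.

(* Chernoff's bound for both tails, according to the sign of [l] *)
Lemma binomial_tail E S (l m : R) : S \subset E ->
  Pr E (fun G => l * m <= l * #|G :&: S|%:R) <=
  expR (p * #|S|%:R * (expR l - 1) - l * m).
Proof.
move=> sS; case/andP: (p01) => p0 p1.
have h : Pr E (fun G => l * m <= l * #|G :&: S|%:R) <=
    expR (- (l * m)) * Ex E (fun G => expR l ^+ #|G :&: S|).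
  rewrite -ExZ; apply: le_Ex => G _; case: (boolP (l * m <= _)) => [lm|_] /=; last first.
    by rewrite mulr0n mulr_ge0 ?exprn_ge0 ?expR_ge0.
  rewrite -expRM_natr -expRD.
  apply: (@le_trans _ _ (expR 0)); first by rewrite expR0.
  by rewrite ler_expR addrC subr_ge0.
apply: (le_trans h); rewrite Ex_pow // [X in _ <= expR X]addrC expRD ler_pM2l ?expR_gt0 //.
rewrite (_ : 1 - p + _ = 1 + p * (expR l - 1)); last by ring.
apply: (le_trans (expX_ge _ _)); last by rewrite ler_expR mulrA [_ * p]mulrC.
by have := mulr_ge0 p0 (expR_ge0 l); lra.
Qed.

End RandomSubset.

(** * Spans over Z/2 and cocycles *)

Section Parity.
Variable T : finType.
Implicit Types (S D : {set T}) (F : {set {set T}}).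

(** Here [d] stands for the linear functional over Z/2 with these values on single edges, evaluated
    at the vector [S]. *)
Definition pairing S (d : T -> bool) : bool := \big[addb/false]_(e in S) d e.

Lemma odd_card (I : finType) (A : {set I}) :
  odd #|A| = \big[addb/false]_(i in A) true.
Proof.
rewrite -sum1_card (big_morph odd oddD (erefl _)) //.
Qed.

Lemma pairingE S d : pairing S d = \big[addb/false]_e ((e \in S) && d e).
Proof. by rewrite /pairing big_mkcond /=; apply: eq_bigr => e _; case: ifP. Qed.

End Parity.

Section SpanDuality.
Variable n : nat.
Local Notation E := {set 'I_n}.
Implicit Types (S A : {set E}) (F : {set {set E}}).

Lemma mem_esum F e : (e \in Defs.esum F) = \big[addb/false]_(S in F) (e \in S).
Proof.
rewrite inE odd_card big_mkcond [RHS]big_mkcond /=; apply: eq_bigr => S _.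
by rewrite inE; do 2 case: (_ \in _).
Qed.

Lemma pairing_esum F d :
  pairing (Defs.esum F) d = \big[addb/false]_(S in F) pairing S d.
Proof.
rewrite pairingE (eq_bigr (fun e => \big[addb/false]_(S in F) ((e \in S) && d e))).
  by rewrite exchange_big; apply: eq_bigr => S _; rewrite -pairingE.
by move=> e _; rewrite mem_esum big_distrl.
Qed.

Definition symdiff S A : {set E} := [set e | (e \in S) (+) (e \in A)].

Lemma pairing_symdiff S A d :
  pairing (symdiff S A) d = pairing S d (+) pairing A d.
Proof.
rewrite !pairingE -big_split /=; apply: eq_bigr => e _.
by rewrite inE; case: (e \in S); case: (e \in A); case: (d e).
Qed.

Lemma in_spanP F S :
  reflect (exists2 sub : {set {set E}}, sub \subset F & Defs.esum sub = S) (in_span F S).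
Proof.
apply: (iffP existsP) => [[sub /andP[? /eqP]]|[sub ? /eqP]]; exists sub => //.
exact/andP.
Qed.

Lemma in_span_setU1 A F S : A \notin F ->
  in_span F S || in_span F (symdiff S A) -> in_span (A |: F) S.
Proof.
move=> AF /orP[] /in_spanP[sub sF eS]; apply/in_spanP.
  by exists sub => //; rewrite subsetU ?sF ?orbT.
exists (A |: sub); first by rewrite setUS.
apply/setP => e; rewrite mem_esum big_setU1 /=; last exact: contra (subsetP sF _) AF.
by rewrite -mem_esum eS inE addbCA addbb addbF.
Qed.

(** Induction on the generators. If [S] is outside the span of [A |: F], then [S] and [S + A] are
    outside the span of [F] and have separating functionals [d1] and [d2]. One that vanishes on [A]
    still separates [S]; if neither does, [d1 + d2] vanishes on [A] and takes the value 1 + 0 at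
    [S]. *)
Lemma span_separation F S : ~~ in_span F S ->
  exists d : E -> bool, (forall A, A \in F -> pairing A d = false) /\ pairing S d.
Proof.
elim/set_ind_card: F S => [|A F AF IH] S nS.
  have [e eS] : exists e, e \in S.
    apply/set0Pn; apply: contra nS => /eqP->; apply/in_spanP.
    exists set0; first exact: sub0set.
    by apply/setP => e; rewrite mem_esum big_set0 inE.
  exists (pred1 e); split=> [A|]; first by rewrite inE.
  rewrite /pairing (bigD1 e) //= eqxx big1 // => i /andP[_ /negbTE]; by [].
have [n1 n2] : ~~ in_span F S /\ ~~ in_span F (symdiff S A).
  by apply/andP; rewrite -negb_or; apply: contra nS; exact: in_span_setU1.
have [d1 [d1F d1S]] := IH _ n1; have [d2 [d2F]] := IH _ n2.
rewrite pairing_symdiff => d2S.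
case d1A : (pairing A d1); last first.
  by exists d1; split => // B /setU1P[->//|/d1F].
case d2A : (pairing A d2); last first.
  exists d2; split => [B /setU1P[->//|/d2F]//|].
  by move: d2S; rewrite d2A addbF.
have dD B : pairing B (fun e => d1 e (+) d2 e) = pairing B d1 (+) pairing B d2.
  exact: big_split.
exists (fun e => d1 e (+) d2 e); split => [B /setU1P[->|BF]|]; rewrite dD.
- by rewrite d1A d2A.
- by rewrite d1F // d2F.
- by rewrite d1S; move: d2S; rewrite d2A; case: (pairing S d2).
Qed.

Lemma pairing_in_span F S d :
  (forall A, A \in F -> pairing A d = false) -> in_span F S -> pairing S d = false.
Proof.
move=> Fd /in_spanP[sub /subsetP sF <-]; rewrite pairing_esum big1 // => A /sF.
exact: Fd.
Qed.

End SpanDuality.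

(** * Cocycles, cuts and the edge sets of cycles *)

Section Cocycles.
Variable n : nat.
Local Notation E := {set 'I_n}.
Implicit Types (G F S : {set E}) (x y z : 'I_n).

Definition cocycle G F := forall x y z,
  [set x; y] \in G -> [set y; z] \in G -> [set x; z] \in G ->
  ([set x; y] \in F) (+) ([set y; z] \in F) (+) ([set x; z] \in F) = false.

Definition coboundary G F := exists h : {set 'I_n}, forall x y,
  [set x; y] \in G -> ([set x; y] \in F) = (x \in h) (+) (y \in h).

Lemma edge_neq G x y : G \subset edge_set n -> [set x; y] \in G -> x != y.
Proof.
move=> /subsetP sG /sG; rewrite inE cards2; by case: (x != y).
Qed.

Lemma set2_eqP x y z t : [set x; y] = [set z; t] ->
  (x = z /\ y = t) \/ (x = t /\ y = z).
Proof.
move=> e; have /set2P[xz|xt] : x \in [set z; t] by rewrite -e set21.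
  have : y \in [set z; t] by rewrite -e set22.
  case/set2P => [yz|]; last by left.
  have : t \in [set x; y] by rewrite e set22.
  by rewrite xz yz setUid => /set1P ->; left.
have : y \in [set z; t] by rewrite -e set22.
case/set2P => [|yt]; first by right.
have : z \in [set x; y] by rewrite e set21.
by rewrite xt yt setUid => /set1P ->; left.
Qed.

(** Length at least 3 makes the edges of a cycle pairwise distinct; in a closed walk of length 2
    both vertices would give the same edge. *)
Lemma next_next_neq (s : seq 'I_n) x : uniq s -> (2 < size s)%N -> x \in s ->
  next s (next s x) != x.
Proof.
move=> us ss /rot_to[i s' es].
rewrite -!(next_rot i us) es; have := us; rewrite -(rot_uniq i) es.
have := ss; rewrite -(size_rot i) es.
case: s' {es} => [|y [|z r]] //= _ /andP[]; rewrite !inE !negb_or.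
by move=> /and3P[xy xz _] _; rewrite !eqxx [y == x]eq_sym (negbTE xy) eq_sym.
Qed.

Lemma cyc_edges_inj (s : seq 'I_n) : uniq s -> (2 < size s)%N ->
  {in s &, injective (fun x => [set x; next s x])}.
Proof.
move=> us ss x y xs ys /set2_eqP[[]//|[e1 e2]].
have := next_next_neq us ss ys; rewrite -e1.
by rewrite -e2 eqxx.
Qed.

Lemma pairing_cyc_edges (s : seq 'I_n) (d : E -> bool) : uniq s -> (2 < size s)%N ->
  pairing (cyc_edges s) d = \big[addb/false]_(x <- s) d [set x; next s x].
Proof.
move=> us ss; rewrite /pairing /cyc_edges big_imset /=; last exact: cyc_edges_inj.
rewrite [RHS]big_uniq //=.
Qed.

Lemma cycles_of_lenP G (P : nat -> bool) S :
  reflect (exists t : seq 'I_n, [/\ (2 < size t)%N, P (size t), uniq t,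
             S = cyc_edges t & S \subset G]) (S \in cycles_of_len G P).
Proof.
rewrite inE; apply: (iffP existsP).
  move=> [k /existsP[t /and5P[k3 Pk ut /eqP eS sS]]].
  by exists t; rewrite size_tuple; split.
move=> [t [k3 Pk ut eS sS]].
have tn : (size t < n.+1)%N.
  by rewrite ltnS -(card_uniqP ut) -[X in (_ <= X)%N]card_ord max_card.
exists (Ordinal tn); apply/existsP; exists (in_tuple t).
by apply/and5P; split => //; apply/eqP.
Qed.

Lemma triangle_in_triangles G x y z : G \subset edge_set n ->
  [set x; y] \in G -> [set y; z] \in G -> [set x; z] \in G ->
  cyc_edges [:: x; y; z] \in triangles G /\
  forall d, pairing (cyc_edges [:: x; y; z]) d =
    d [set x; y] (+) d [set y; z] (+) d [set x; z].
Proof.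
move=> sG xy yz xz.
have nxy := edge_neq sG xy; have nyz := edge_neq sG yz; have nxz := edge_neq sG xz.
have u : uniq [:: x; y; z] by rewrite /= !inE negb_or nxy nxz nyz.
have ex : next [:: x; y; z] x = y by rewrite /= eqxx.
have ey : next [:: x; y; z] y = z by rewrite /= eqxx eq_sym (negbTE nxy).
have ez : next [:: x; y; z] z = x.
  by rewrite /= eqxx eq_sym (negbTE nxz) eq_sym (negbTE nyz).
split.
  apply/cycles_of_lenP; exists [:: x; y; z]; split=> //.
  apply/subsetP => e /imsetP[w]; rewrite !inE => /or3P[] /eqP-> ->.
  - by rewrite ex.
  - by rewrite ey.
  - by rewrite ez setUC.
move=> d; rewrite pairing_cyc_edges // !big_cons big_nil ex ey ez addbF.
by rewrite [[set z; x]]setUC addbA.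
Qed.

(** A functional that kills the triangles but not [S] is, restricted to [G], a cocycle and hence a
    cut. But a cut meets every cycle evenly, so it kills [S] as well. *)
Lemma triangle_space_cocycles G : G \subset edge_set n ->
  (forall F, F \subset G -> cocycle G F -> coboundary G F) ->
  triangle_space_eq_cycle_space G.
Proof.
move=> sG H; apply/forallP => S; apply/eqP; apply/idP/idP.
  move=> /in_spanP[sub sF eS]; apply/in_spanP; exists sub => //.
  apply: (subset_trans sF); apply/subsetP => A /cycles_of_lenP[t [? ? ? ? ?]].
  by apply/cycles_of_lenP; exists t; split.
move=> Sc; apply: contraT => /span_separation[d [dT dS]].
pose F := [set e in G | d e].
have [|x y z xy yz xz|h hF] := H F.
- by apply/subsetP => e; rewrite inE => /andP[].
- rewrite !inE xy yz xz /=.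
  by have [/dT + e] := triangle_in_triangles sG xy yz xz; rewrite e.
suff : pairing S d = false by rewrite dS.
apply: (pairing_in_span _ Sc) => A /cycles_of_lenP[t [st _ ut -> /subsetP sA]].
rewrite pairing_cyc_edges //.
rewrite (eq_big_seq (fun x => (x \in h) (+) (next t x \in h))); last first.
  move=> x xt; have eG : [set x; next t x] \in G by apply/sA/imsetP; exists x.
  by rewrite -hF // inE eG.
rewrite big_split /=.
have -> : \big[addb/false]_(i <- t) (next t i \in h) =
          \big[addb/false]_(i <- [seq next t i | i <- t]) (i \in h).
  by rewrite big_map.
(* [next t] permutes the vertices of [t], so the two ends of the edges contribute equal sums, which
   cancel. *)
suff pe : perm_eq [seq next t i | i <- t] t by rewrite (perm_big _ pe) addbb.
have us : uniq [seq next t i | i <- t].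
  by rewrite map_inj_uniq //; exact: (can_inj (prev_next ut)).
apply: uniq_perm => //.
have [||//] := uniq_min_size us (s2 := t).
  by move=> y /mapP[x xt ->]; rewrite mem_next.
by rewrite size_map.
Qed.

End Cocycles.

(** * A cocycle close to a cut is a cut *)

Section Graphs.
Variable n : nat.
Local Notation E := {set 'I_n}.
Implicit Types (G F S : {set E}) (x y z v : 'I_n) (A B : {set 'I_n}).

Definition nbr G x : {set 'I_n} := [set y | [set x; y] \in G].
Definition codeg G x y : nat := #|nbr G x :&: nbr G y|.
(** Ordered pairs are counted, so [edges_between G A A] is twice the number of edges inside [A]. *)
Definition edges_between G A B : nat := \sum_(x in A) #|nbr G x :&: B|.

Lemma card_sum_mem (I : finType) (A : {set I}) : #|A| = (\sum_i (i \in A : nat))%N.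
Proof. by rewrite -sum1_card big_mkcond /=; apply: eq_bigr => i _; case: ifP. Qed.

Lemma nbrC G x y : (x \in nbr G y) = (y \in nbr G x).
Proof. by rewrite !inE setUC. Qed.

Lemma edges_betweenE G A B :
  edges_between G A B = (\sum_x \sum_y ([&& x \in A, y \in B & y \in nbr G x] : nat))%N.
Proof.
rewrite /edges_between big_mkcond /=; apply: eq_bigr => x _.
case: ifP => xA; last by rewrite big1.
by rewrite card_sum_mem; apply: eq_bigr => y _; rewrite inE andbC.
Qed.

(* The edges at [v] of the sum of [F] and the cut defined by [h]; the A_v of the header. *)
Definition resid G F (h : {set 'I_n}) v : {set 'I_n} :=
  [set u in nbr G v | ([set v; u] \in F) (+) (v \in h) (+) (u \in h)].

Lemma residC G F h u v : (u \in resid G F h v) = (v \in resid G F h u).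
Proof. by rewrite !inE setUC addbAC. Qed.

Lemma resid_sub G F h v : resid G F h v \subset nbr G v.
Proof. by apply/subsetP => u; rewrite inE => /andP[]. Qed.

Lemma resid_triangle G F h x y z : cocycle G F ->
  y \in nbr G x -> z \in nbr G y -> z \in nbr G x ->
  (y \in resid G F h x) (+) (z \in resid G F h y) (+) (z \in resid G F h x) = false.
Proof.
move=> cF; rewrite !inE => xy yz xz; rewrite xy yz xz /= -(cF _ _ _ xy yz xz).
by case: (x \in h); case: (y \in h); case: (z \in h); rewrite ?addbT ?addbF ?addbN ?addNb ?negbK.
Qed.

Definition resid_size G F h : nat := (\sum_v #|resid G F h v|)%N.

(** Moving [v] across the cut complements its residual neighbourhood inside [nbr G v] and changes no
    edge away from [v]; a minimal [h] therefore keeps the smaller half. *)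
Lemma resid_switch G F h v : G \subset edge_set n ->
  (forall h', resid_size G F h <= resid_size G F h')%N ->
  (#|resid G F h v|.*2 <= #|nbr G v|)%N.
Proof.
move=> sG hmin; pose h' := [set u | (u \in h) (+) (u == v)].
have vN : v \notin nbr G v.
  by rewrite inE; apply/negP => /(edge_neq sG); rewrite eqxx.
(* The residual edges at [v] are split off; each is counted from both of its ends, hence the
   double. *)
have sizeE k : resid_size G F k =
   (\sum_(x | x != v) \sum_(y | y != v) (y \in resid G F k x) + (#|resid G F k v|).*2)%N.
  rewrite /resid_size (bigD1 v) //= addnC -addnn addnA; congr (_ + _)%N.
  rewrite [X in (_ + X)%N]card_sum_mem [X in (_ + X)%N](bigD1 v) //=.
  rewrite (_ : v \in resid G F k v = false); last first.
    by apply: contraNF vN; exact/subsetP/resid_sub.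
  rewrite add0n -big_split /=; apply: eq_bigr => x xv.
  by rewrite card_sum_mem (bigD1 v) //= addnC residC.
have := hmin h'; rewrite !sizeE.
have -> : (\sum_(x | x != v) \sum_(y | y != v) (y \in resid G F h' x) =
           \sum_(x | x != v) \sum_(y | y != v) (y \in resid G F h x))%N.
  apply: eq_bigr => x xv; apply: eq_bigr => y yv.
  by rewrite !inE (negbTE xv) (negbTE yv) !addbF.
rewrite leq_add2l leq_double => le.
have <- : (#|resid G F h v| + #|resid G F h' v|)%N = #|nbr G v|.
  rewrite !card_sum_mem -big_split /=; apply: eq_bigr => u _.
  case: (boolP (u \in nbr G v)) => uN; last by rewrite !inE; move: uN; rewrite inE => /negbTE ->.
  have uv : u != v by apply: contraNneq vN => e; rewrite -{1}e.
  move: uN; rewrite !inE => ->; rewrite eqxx (negbTE uv) /= addbF.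
  by case: (_ \in F); case: (v \in h); case: (u \in h).
by rewrite -addnn leq_add2l.
Qed.

(** In a triangle [v x y] with [v x] residual, exactly one of [v y] and [x y] is residual too, so
    the two residual edges meet at [v] or at [x]. The two cases are exchanged by swapping [v] and
    [x], whence the double. *)
Lemma codeg_sum G F h : cocycle G F ->
  (\sum_v \sum_(x in resid G F h v) codeg G v x)%N =
  ((\sum_v edges_between G (resid G F h v) (resid G F h v)).*2)%N.
Proof.
move=> cF; pose f v x := x \in resid G F h v; pose g v x := x \in nbr G v.
transitivity (\sum_v \sum_x \sum_y ([&& f v x, g x y & g v y] : nat))%N.
  apply: eq_bigr => v _; rewrite big_mkcond; apply: eq_bigr => x _ /=.
  rewrite -/(f v x); case: (f v x) => /=; last by rewrite big1.
  by rewrite /codeg card_sum_mem; apply: eq_bigr => y _; rewrite inE andbC.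
have fg v x : f v x -> g v x by exact/subsetP/resid_sub.
transitivity (\sum_v \sum_x \sum_y ([&& f v x, f v y & g x y] + [&& f v x, f x y & g v y] : nat))%N.
  apply: eq_bigr => v _; apply: eq_bigr => x _; apply: eq_bigr => y _.
  case fvx : (f v x) => //=; case gxy : (g x y) => /=; last first.
    by case fxy : (f x y) => /=; rewrite ?andbF //; move: gxy; rewrite fg.
  case gvy : (g v y) => /=; last first.
    by case fvy : (f v y) => /=; rewrite ?andbF //; move: gvy; rewrite fg.
  have := resid_triangle h cF (fg _ _ fvx) gxy gvy.
  by rewrite -/(f _ _) -/(f _ _) -/(f _ _) fvx; case: (f x y); case: (f v y).
under eq_bigr do under eq_bigr do rewrite big_split /=.
under eq_bigr do rewrite big_split /=.
rewrite big_split /= -addnn; congr (_ + _)%N.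
  by apply: eq_bigr => v _; rewrite edges_betweenE.
rewrite exchange_big /=; apply: eq_bigr => v _; rewrite edges_betweenE.
apply: eq_bigr => x _; apply: eq_bigr => y _.
by rewrite /f residC.
Qed.

(** Take [v] in [H], a residual neighbour [x] and a non-residual neighbour [y] of [v]. If [x y] is
    an edge, parity makes it residual, so [v] and [y] both lie in the residual neighbourhood of [x].
    Such triples are counted at [x]: inside that neighbourhood if [x] is outside [H], and as common
    neighbours [y] of an edge [x v] within [H] otherwise. *)
Lemma cross_sum G F h (H : {set 'I_n}) : cocycle G F ->
  (\sum_(v in H) edges_between G (resid G F h v) (nbr G v :\: resid G F h v) <=
   \sum_(x in ~: H) edges_between G (resid G F h x) (resid G F h x) +
   \sum_(x in H) \sum_(v in nbr G x :&: H) codeg G x v)%N.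
Proof.
move=> cF; pose f v x := x \in resid G F h v; pose g v x := x \in nbr G v.
have fg v x : f v x -> g v x by exact/subsetP/resid_sub.
apply: (@leq_trans (\sum_(v in H) \sum_x \sum_y ([&& f x v, f x y & g v y] : nat))%N).
  apply: leq_sum => v vH; rewrite edges_betweenE.
  apply: leq_sum => x _; apply: leq_sum => y _.
  rewrite -/(f v x) -/(g x y) !in_setD -/(f v y) -/(g v y).
  case fvx : (f v x) => //=; case fvy : (f v y) => //=.
  case gvy : (g v y) => //=; case gxy : (g x y) => //=.
  rewrite {1}/f residC -/(f v x) fvx /=.
  have := resid_triangle h cF (fg _ _ fvx) gxy gvy.
  by rewrite -/(f _ _) -/(f _ _) -/(f _ _) fvx fvy; case: (f x y).
rewrite exchange_big /= (bigID (mem H)) /= addnC; apply: leq_add.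
  rewrite [leqRHS](eq_bigl (fun x => x \notin H)); last by move=> x; rewrite inE.
  apply: leq_sum => x _; rewrite edges_betweenE.
  rewrite big_mkcond; apply: leq_sum => v _ /=; case: ifP => //.
apply: leq_sum => x xH.
rewrite big_mkcond [leqRHS]big_mkcond /=; apply: leq_sum => v _; rewrite inE.
case: (v \in H); rewrite ?andbF // andbT -/(g x v).
case gxv : (g x v); last first.
  by rewrite big1 // => y _; case fxv: (f x v) => //; move: gxv; rewrite fg.
rewrite /codeg card_sum_mem; apply: leq_sum => y _; rewrite inE.
rewrite -/(g _ _) -/(g v y); case: (f x v) => //=.
by case fxy : (f x y) => //=; rewrite (fg _ _ fxy).
Qed.

End Graphs.

(** * Deterministic rigidity from regularity conditions *)

Section Rigidity.
Variables (R : realType) (n : nat).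
Implicit Types (G F : {set {set 'I_n}}) (A S h : {set 'I_n}).

(** In the application [d] = n p and [q] = n p^2 are the scales of degrees and codegrees, [K] is 7
    and [kappa] is 1/16. The densities [tau1] and [tau2] are small, at the price of the size limits
    [theta] and [sigma]. *)
Record regular G (K eta kappa tau1 tau2 theta sigma q d : R) : Prop := Regular {
  codeg_lower : forall x y, [set x; y] \in G -> eta * q <= (codeg G x y)%:R;
  codeg_upper : forall x y, x != y -> (codeg G x y)%:R <= K * q;
  nbhd_sparse : forall A, #|A|%:R <= theta * d ->
    (edges_between G A A)%:R <= tau1 * #|A|%:R * q;
  link_expansion : forall v A, A \subset nbr G v -> theta * d <= #|A|%:R ->
    (#|A|.*2 <= #|nbr G v|)%N ->
    kappa * #|A|%:R * q <= (edges_between G A (nbr G v :\: A))%:R;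
  small_sparse : forall S, #|S|%:R <= sigma * n%:R ->
    (edges_between G S S)%:R <= tau2 * #|S|%:R * d }.

Lemma regular_coboundary G F (K eta kappa tau1 tau2 theta sigma q d : R) :
  G \subset edge_set n -> regular G K eta kappa tau1 tau2 theta sigma q d ->
  0 < q -> 0 < d -> 0 < K -> 0 < eta -> 0 < theta -> 0 < tau1 -> 0 < tau2 ->
  4 * tau1 <= eta -> 4 * K * tau1 * theta + K * tau2 * eta < kappa * theta * eta ->
  cocycle G F ->
  (exists h, (resid_size G F h)%:R <= theta * sigma * n%:R * d) ->
  coboundary G F.
Proof.
move=> sG reg q0 d0 K0 eta0 theta0 t10 t20 t1eta hk cF [h0 hh0].
case: (@arg_minnP _ h0 xpredT (resid_size G F) isT) => h _ hmin.
have {}hmin k := hmin k isT; have {h0 hh0}hsize : (resid_size G F h)%:R <= theta * sigma * n%:R * d.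
  by apply: le_trans hh0; rewrite ler_nat.
pose A v := resid G F h v; pose a v : R := #|A v|%:R.
pose H := [set v | theta * d <= a v].
pose e v : R := (edges_between G (A v) (A v))%:R.
have a0 v : 0 <= a v by rewrite ler0n.
have As v x : x \in A v -> [set v; x] \in G.
  by move/(subsetP (resid_sub G F h v)); rewrite inE.
have An v x : x \in A v -> v != x by move/As; exact: edge_neq sG.
pose aH := \sum_(v in H) a v; pose aL := \sum_(v in ~: H) a v.
have split_H (f : 'I_n -> R) : \sum_v f v = \sum_(v in H) f v + \sum_(v in ~: H) f v.
  rewrite (bigID (mem H)) /=; congr (_ + _); apply: eq_bigl => v.
  by rewrite in_setC.
have aE : (resid_size G F h)%:R = aH + aL by rewrite natr_sum split_H.
have aH0 : 0 <= aH by exact: sumr_ge0.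
have aL0 : 0 <= aL by exact: sumr_ge0.
have eL v : v \in ~: H -> e v <= tau1 * a v * q.
  rewrite !inE -ltNge => /ltW; exact: nbhd_sparse reg _.
have eH v : e v <= K * q * a v.
  apply: (@le_trans _ _ (\sum_(x in A v) (codeg G v x)%:R)).
    rewrite /e natr_sum; apply: ler_sum => x xA; rewrite ler_nat.
    by rewrite /codeg [nbr G v :&: _]setIC; apply/subset_leq_card/setIS/resid_sub.
  apply: (@le_trans _ _ (\sum_(x in A v) (K * q))); last first.
    by rewrite sumr_const mulr_natr.
  by apply: ler_sum => x xA; rewrite (codeg_upper reg) ?(An _ _ xA).
(* In the double count every codegree is at least [eta * q], while the vertices off [H] return at
   most [2 * tau1 * q] per unit of [aL], half of [eta * q] at most. So [aL] is controlled by
   [aH]. *)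
have h1 : eta * aL <= 4 * K * aH.
  have lo : eta * q * (aH + aL) <= 2 * (\sum_v e v).
    have <- : \sum_v \sum_(x in A v) (codeg G v x)%:R = 2 * \sum_v e v :> R.
      have /(congr1 (fun m : nat => m%:R : R)) := codeg_sum h cF.
      rewrite -muln2 natrM mulrC !natr_sum => <-.
      by apply: eq_bigr => v _; rewrite natr_sum.
    rewrite -aE natr_sum mulr_sumr; apply: ler_sum => v _.
    rewrite mulr_natr -sumr_const; apply: ler_sum => x /As xA.
    exact: codeg_lower reg _ _ xA.
  have up : \sum_v e v <= K * q * aH + tau1 * q * aL.
    rewrite split_H; apply: lerD; rewrite mulr_sumr; apply: ler_sum => v vH //.
    by rewrite mulrAC; exact: eL.
  have t1L : 4 * tau1 * (q * aL) <= eta * (q * aL) by rewrite ler_wpM2r // mulr_ge0 // ltW.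
  have eH0 : 0 <= eta * q * aH by rewrite !mulr_ge0 // ltW.
  by rewrite -(ler_pM2r q0); lra.
have hH : theta * d * #|H|%:R <= aH.
  rewrite mulr_natr -sumr_const; apply: ler_sum => v; by rewrite inE.
(* Minimality of [h] makes [link_expansion] available on [H], and [cross_sum] relocates the edges
   found. The part inside [H] is small because [hH] and the size of the residue bound [#|H|] by
   [sigma * n]. *)
have h2 : kappa * q * aH <= tau1 * q * aL + K * q * tau2 * #|H|%:R * d.
  apply: (@le_trans _ _ (\sum_(v in H) (edges_between G (A v) (nbr G v :\: A v))%:R)).
    rewrite mulr_sumr; apply: ler_sum => v; rewrite inE => vH.
    rewrite mulrAC; apply: (link_expansion reg) => //; first exact: resid_sub.
    exact: resid_switch.
  rewrite -natr_sum; apply: (@le_trans _ _ _%:R).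
    by rewrite ler_nat; exact: (cross_sum h H cF).
  rewrite natrD !natr_sum; apply: lerD.
    rewrite mulr_sumr; apply: ler_sum => v vH.
    by rewrite mulrAC; exact: eL.
  have HS : (edges_between G H H)%:R <= tau2 * #|H|%:R * d.
    apply: (small_sparse reg); rewrite -(ler_pM2l (mulr_gt0 theta0 d0)).
    apply: (le_trans hH); rewrite (_ : _ * (sigma * _) = theta * sigma * n%:R * d); last by ring.
    by apply: le_trans hsize; rewrite aE lerDl.
  rewrite (_ : K * q * _ * _ * _ = K * q * (tau2 * #|H|%:R * d)); last by ring.
  apply: (@le_trans _ _ (K * q * (edges_between G H H)%:R)); last first.
    by rewrite ler_pM2l // mulr_gt0.
  rewrite natr_sum mulr_sumr; apply: ler_sum => x _.
  rewrite natr_sum mulr_natr -sumr_const; apply: ler_sum => v; rewrite !inE => /andP[xv _].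
  by rewrite (codeg_upper reg) // (edge_neq sG xv).
have aH_eq : aH = 0.
  apply/eqP; rewrite eq_le aH0 andbT leNgt; apply/negP => aHp.
  (* [h2] times [theta * eta]; then [aL] is eliminated by [h1] and [#|H|] by [hH], which contradicts
     the assumed inequality between the constants. *)
  have h3 : kappa * q * aH * (theta * eta) <=
            (tau1 * q * aL + K * q * tau2 * #|H|%:R * d) * (theta * eta).
    by rewrite ler_pM2r // mulr_gt0.
  have h4 : tau1 * q * theta * (eta * aL) <= tau1 * q * theta * (4 * K * aH).
    by rewrite ler_pM2l // !mulr_gt0.
  have h5 : K * q * tau2 * eta * (theta * d * #|H|%:R) <= K * q * tau2 * eta * aH.
    by rewrite ler_pM2l // !mulr_gt0.
  have h6 : (4 * K * tau1 * theta + K * tau2 * eta) * (q * aH) < kappa * theta * eta * (q * aH).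
    by rewrite ltr_pM2r // mulr_gt0.
  suff : kappa * theta * eta * (q * aH) <= (4 * K * tau1 * theta + K * tau2 * eta) * (q * aH).
    by rewrite leNgt h6.
  lra.
have aL_eq : aL = 0.
  by apply/eqP; rewrite eq_le aL0 andbT -(ler_pM2l eta0) mulr0 (le_trans h1) // aH_eq mulr0.
exists h => x y xy; move: aE; rewrite aH_eq aL_eq addr0 => /eqP.
rewrite pnatr_eq0 sum_nat_eq0 => /forallP/(_ x); rewrite cards_eq0 => /eqP.
move=> /setP/(_ y); rewrite !inE xy /=.
by case: (_ \in F); case: (x \in h); case: (y \in h).
Qed.

End Rigidity.

(** * Degrees, codegrees and edge counts in the random graph *)

Section EdgesOfPairs.
Variable n : nat.
Implicit Types (G : {set {set 'I_n}}) (P : {set 'I_n * 'I_n}) (A B X Y : {set 'I_n}).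

Definition uedge (u : 'I_n * 'I_n) : {set 'I_n} := [set u.1; u.2].
(** Counts run over ordered pairs, the random graph over unordered ones. Forgetting the order loses
    at most a factor 2: nothing for pairs between disjoint sets, exactly 2 for symmetric loopless
    sets of pairs. *)
Definition uedges P : {set {set 'I_n}} := uedge @: P.

Lemma uedges_sub P : (forall u, u \in P -> u.1 != u.2) -> uedges P \subset edge_set n.
Proof.
move=> Pn; apply/subsetP => e /imsetP[u uP ->].
by rewrite inE cards2 Pn.
Qed.

Lemma uedge_eq u v : uedge u = uedge v -> u = v \/ u = (v.2, v.1).
Proof.
case: u v => [x y] [z t] /set2_eqP /= [[-> ->]|[-> ->]]; [by left | by right].
Qed.

Lemma card_uedges_le P : (#|uedges P| <= #|P|)%N.
Proof. exact: leq_imset_card. Qed.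

Lemma card_uedges_ge P : (#|P| <= #|uedges P|.*2)%N.
Proof.
rewrite -sum1_card (partition_big_imset uedge) /= -muln2 -sum_nat_const.
apply: leq_sum => e /imsetP[v vP ->].
rewrite sum1_card; apply: (@leq_trans #|[set v; (v.2, v.1)]|); last first.
  by rewrite cards2 ltnS leq_b1.
apply: subset_leq_card; apply/subsetP => u /andP[_ /eqP /uedge_eq[]->].
  by rewrite set21.
by rewrite set22.
Qed.

Lemma card_uedges_sym P : (forall u, u \in P -> u.1 != u.2 /\ (u.2, u.1) \in P) ->
  #|P| = #|uedges P|.*2.
Proof.
move=> Ps; rewrite -sum1_card (partition_big_imset uedge) /= -muln2 -sum_nat_const.
apply: eq_bigr => e /imsetP[v vP ->]; have [v12 vP'] := Ps _ vP.
have <- : #|[set v; (v.2, v.1)]| = 2%N.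
  rewrite cards2; case: eqP => //; case: v v12 {vP vP'} => x y /= /eqP xy [] /xy [].
rewrite sum1_card; apply: eq_card => u; rewrite !inE.
apply/andP/orP => [[_ /eqP /uedge_eq[]->]|[] /eqP ->].
- by left.
- by right.
- by rewrite eqxx.
- by rewrite vP' /uedge /= setUC.
Qed.

Lemma card_uedges_bip P X Y : [disjoint X & Y] -> P \subset finset.setX X Y ->
  #|uedges P| = #|P|.
Proof.
move=> dXY /subsetP PXY; apply: card_in_imset => u v /PXY + /PXY.
rewrite !inE => /andP[u1 u2] /andP[v1 v2] /uedge_eq[//|uv].
by move: u1; rewrite uv /= => /(disjointFr dXY); rewrite v2.
Qed.

Lemma uedgesI G P : G :&: uedges P = uedges [set u in P | uedge u \in G].
Proof.
apply/setP => e; rewrite inE; apply/andP/imsetP => [[eG /imsetP[u uP ue]]|[u]].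
  by exists u; rewrite // inE uP -ue.
by rewrite inE => /andP[uP uG] ->; split=> //; apply/imsetP; exists u.
Qed.

Lemma card_pairs P : #|P| = (\sum_x \sum_y ((x, y) \in P : nat))%N.
Proof.
by rewrite card_sum_mem pair_bigA; apply: eq_bigr => -[].
Qed.

Lemma sum_nbr_pairs G (S : 'I_n -> {set 'I_n}) A :
  (\sum_(x in A) #|nbr G x :&: S x|)%N =
  #|[set u in [set u | (u.1 \in A) && (u.2 \in S u.1)] | uedge u \in G]|.
Proof.
rewrite card_pairs big_mkcond /=; apply: eq_bigr => x _; case: ifP => xA; last by rewrite big1 //
  => y _; rewrite !inE /= xA.
by rewrite card_sum_mem; apply: eq_bigr => y _; rewrite !inE /= xA andbC.
Qed.

Lemma sum_card_pairs (S : 'I_n -> {set 'I_n}) A :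
  (\sum_(x in A) #|S x|)%N = #|[set u : 'I_n * 'I_n | (u.1 \in A) && (u.2 \in S u.1)]|.
Proof.
rewrite card_pairs big_mkcond /=; apply: eq_bigr => x _; case: ifP => xA; last by rewrite big1 //
  => y _; rewrite !inE /= xA.
by rewrite card_sum_mem; apply: eq_bigr => y _; rewrite !inE /= xA.
Qed.

(** The target may vary with the vertex. If [A] is disjoint from all targets, the sum over [x] in
    [A] of [#|nbr G x :&: S x|] is a single binomial variable. *)
Definition fan A (S : 'I_n -> {set 'I_n}) :=
  uedges [set u : 'I_n * 'I_n | (u.1 \in A) && (u.2 \in S u.1)].

Lemma fan_sub A (S : 'I_n -> {set 'I_n}) : (forall x, x \in A -> x \notin S x) -> fan A S \subset
  edge_set n.
Proof.
move=> AS; apply: uedges_sub => -[x y]; rewrite inE /= => /andP[/AS xS yS].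
by apply: contraNneq xS => e; rewrite [X in X \in _]e.
Qed.

Lemma card_fan A Y (S : 'I_n -> {set 'I_n}) : [disjoint A & Y] -> (forall x, S x \subset Y) ->
  #|fan A S| = (\sum_(x in A) #|S x|)%N.
Proof.
move=> dAY SY; rewrite sum_card_pairs (card_uedges_bip dAY) //.
apply/subsetP => -[x y]; rewrite !inE /= => /andP[-> /=]; exact/subsetP.
Qed.

Lemma cardI_fan G A Y (S : 'I_n -> {set 'I_n}) : [disjoint A & Y] -> (forall x, S x \subset Y) ->
  #|G :&: fan A S| = (\sum_(x in A) #|nbr G x :&: S x|)%N.
Proof.
move=> dAY SY; rewrite sum_nbr_pairs uedgesI (card_uedges_bip dAY) //.
apply/subsetP => -[x y]; rewrite !inE /= => /andP[/andP[-> +] _] /=; exact/subsetP.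
Qed.

Definition clique A := uedges [set u : 'I_n * 'I_n | [&& u.1 \in A, u.2 \in A & u.1 != u.2]].

Lemma clique_sub A : clique A \subset edge_set n.
Proof. by apply: uedges_sub => u; rewrite inE => /and3P[]. Qed.

Lemma card_clique A : (#|clique A|.*2 <= #|A| ^ 2)%N.
Proof.
rewrite -card_uedges_sym; last first.
  by move=> [x y]; rewrite !inE /= => /and3P[-> -> xy]; rewrite [y == x]eq_sym xy.
rewrite -mulnn -cardsX; apply: subset_leq_card; apply/subsetP => u; rewrite !inE.
by move=> /and3P[-> ->].
Qed.

Lemma cardI_clique G A : G \subset edge_set n ->
  edges_between G A A = #|G :&: clique A|.*2.
Proof.
move=> sG; rewrite uedgesI -card_uedges_sym; last first.
  move=> [x y]; rewrite !inE /= => /andP[/and3P[-> -> xy] e].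
  by rewrite xy eq_sym xy /= /uedge /= setUC.
rewrite /edges_between (sum_nbr_pairs G (fun=> A)); apply: eq_card => -[x y]; rewrite !inE /=.
case: (boolP (uedge _ \in G)) => [/(edge_neq sG) /= ->|_]; rewrite ?andbF ?andbT //.
Qed.

End EdgesOfPairs.

(** * Generating function and tails of a codegree *)

Section CodegreeTails.
Variables (R : realType) (n : nat) (p : R).
Implicit Types (G : {set {set 'I_n}}) (x y z : 'I_n) (U : {set 'I_n}).

Definition star x U : {set {set 'I_n}} := fan [set x] (fun=> U).

Lemma mem_star x U y z :
  ([set y; z] \in star x U) = (y == x) && (z \in U) || (z == x) && (y \in U).
Proof.
apply/imsetP/orP => [[[a b]]|[]/andP[/eqP-> zU]].
- rewrite !inE /= => /andP[/eqP -> bU] /set2_eqP[[-> ->]|[-> ->]].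
    by left; rewrite eqxx.
  by right; rewrite eqxx.
- by exists (x, z); rewrite // !inE eqxx.
- by exists (x, y); rewrite /uedge ?inE /= ?eqxx // setUC.
Qed.

Lemma star_sub x U : x \notin U -> star x U \subset edge_set n.
Proof. by move=> xU; apply: fan_sub => y /set1P->. Qed.

Lemma disjoint_set1 x U : x \notin U -> [disjoint [set x] & U].
Proof. by move=> xU; rewrite disjoints_subset sub1set inE. Qed.

Lemma card_star x U : x \notin U -> #|star x U| = #|U|.
Proof.
move=> xU; rewrite (card_fan (disjoint_set1 xU)) //.
by rewrite big_set1.
Qed.

Lemma cardI_star G x U : x \notin U -> #|G :&: star x U| = #|nbr G x :&: U|.
Proof.
move=> xU; rewrite (cardI_fan _ (disjoint_set1 xU)) //.
by rewrite big_set1.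
Qed.

Definition codeg_in G x y U : nat := #|nbr G x :&: nbr G y :&: U|.

Lemma codeg_in_ext G G' x y U :
  (forall z, z \in U -> ([set x; z] \in G) = ([set x; z] \in G') /\
                        ([set y; z] \in G) = ([set y; z] \in G')) ->
  codeg_in G x y U = codeg_in G' x y U.
Proof.
move=> GG'; apply: eq_card => z; rewrite !inE.
by case: (boolP (z \in U)) => [/GG'[-> ->]//|]; rewrite ?andbF.
Qed.

Lemma codeg_in_setC G x y : G \subset edge_set n ->
  codeg G x y = codeg_in G x y (~: [set x; y]).
Proof.
move=> sG; apply: eq_card => z; rewrite !inE negb_or.
case: (boolP ([set x; z] \in G)) => //= /(edge_neq sG) xz.
case: (boolP ([set y; z] \in G)) => //= /(edge_neq sG) yz.
by rewrite eq_sym xz eq_sym yz.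
Qed.

Section TwoStars.
Variables (x y : 'I_n) (U : {set 'I_n}).
Hypotheses (xy : x != y) (xU : x \notin U) (yU : y \notin U).

Let zx z : z \in U -> (z == x) = false.
Proof. by move=> zU; apply: contraNF xU => /eqP <-. Qed.

Let zy z : z \in U -> (z == y) = false.
Proof. by move=> zU; apply: contraNF yU => /eqP <-. Qed.

Lemma disjoint_stars : [disjoint star x U & star y U].
Proof.
rewrite disjoints_subset; apply/subsetP => e /imsetP[[a b]].
rewrite !inE /= => /andP[/eqP -> bU] ->; rewrite mem_star (negbTE xy) (negbTE xU).
by rewrite !andbF.
Qed.

(** Given the star at [x], the codegree is binomial on the neighbours of [x] in [U]. Applying
    [Ex_pow] twice gives the law with success probability p^2, as 1 - p + p (1 - p + p c) = 1 + p^2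
    (c - 1). *)
Lemma codeg_mgf_stars (c : R) :
  Ex p (star x U :|: star y U) (fun G => c ^+ codeg_in G x y U) =
  (1 + p ^+ 2 * (c - 1)) ^+ #|U|.
Proof.
rewrite ExU; last exact: disjoint_stars.
transitivity (Ex p (star x U) (fun G1 => (1 - p + p * c) ^+ #|G1 :&: star x U|)).
  apply: eq_Ex => G1 sG1; rewrite cardI_star //.
  set U' := nbr G1 x :&: U; have yU' : y \notin U' by rewrite inE negb_and yU orbT.
  rewrite -(card_star yU') -(@Ex_pow _ _ p (star y U)); last first.
    apply/subsetP => e /imsetP[[a b]]; rewrite !inE /= => /andP[/eqP -> /andP[_ bU]] ->.
    by rewrite mem_star eqxx bU.
  apply: eq_Ex => G2 sG2; congr (_ ^+ _); rewrite cardI_star //.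
  apply: eq_card => z; rewrite !inE.
  case: (boolP (z \in U)) => zU; rewrite ?andbF ?andbT //.
  have -> : ([set y; z] \in G1) = false.
    apply: contraTF isT => /(subsetP sG1).
    by rewrite mem_star eq_sym (negbTE xy) (zx zU).
  have -> : ([set x; z] \in G2) = false.
    apply: contraTF isT => /(subsetP sG2).
    by rewrite mem_star (negbTE xy) (zy zU).
  by rewrite orbF /= andbC.
rewrite Ex_pow // card_star //; congr (_ ^+ _); ring.
Qed.

Lemma codeg_mgf (c : R) :
  Ex p (edge_set n) (fun G => c ^+ codeg_in G x y U) = (1 + p ^+ 2 * (c - 1)) ^+ #|U|.
Proof.
rewrite -codeg_mgf_stars -(@Ex_restr _ _ p (edge_set n) (star x U :|: star y U)).
  apply: eq_Ex => G sG; congr (_ ^+ _); apply: codeg_in_ext => z zU.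
  by rewrite !inE !mem_star !eqxx zU ?orbT !andbT.
by rewrite subUset !star_sub.
Qed.

(** The edge [x y] lies in neither star and is independent of the codegree. The factor [p] gained
    here lowers the threshold for C^2 from 2 to 3/2. *)
Lemma codeg_mgf_edge (c : R) :
  Ex p (edge_set n) (fun G => ([set x; y] \in G)%:R * c ^+ codeg_in G x y U) =
  p * (1 + p ^+ 2 * (c - 1)) ^+ #|U|.
Proof.
rewrite -codeg_mgf_stars; set S := star x U :|: star y U.
have eS : [set x; y] \notin S.
  by rewrite inE !mem_star !eqxx (negbTE yU) (negbTE xU) eq_sym (negbTE xy).
rewrite -(@eq_Ex _ _ _ _ (fun G => ([set x; y] \in G :&: ([set x; y] |: S))%:R *
            c ^+ codeg_in (G :&: ([set x; y] |: S)) x y U)); last first.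
  move=> G sG; rewrite !inE eqxx andbT; congr (_ * _ ^+ _); apply: codeg_in_ext => z zU.
  by rewrite !inE !mem_star !eqxx zU ?orbT !andbT.
rewrite (@Ex_restr _ _ p (edge_set n) _ (fun G => ([set x; y] \in G)%:R * c ^+ codeg_in G x y
  U)); last first.
  rewrite !subUset sub1set inE cards2 xy !star_sub //.
rewrite ExU1 // [X in _ + _ * X](_ : _ = 0) ?mulr0 ?addr0; last first.
  rewrite -[RHS](Ex_const p S 0); apply: eq_Ex => G sG.
  by rewrite (negbTE (contra (subsetP sG _) eS)) mul0r.
congr (_ * _); apply: eq_Ex => G sG; rewrite setU11 mul1r; congr (_ ^+ _).
apply: codeg_in_ext => z zU; rewrite !inE.
have zE w : ([set w; z] == [set x; y]) = false.
  apply/negP => /eqP /set2_eqP[[_ e]|[_ e]].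
    by move: yU; rewrite -e zU.
  by move: xU; rewrite -e zU.
by rewrite !zE.
Qed.

Hypothesis p01 : 0 <= p <= 1.

Let mgf_le l : (1 + p ^+ 2 * (expR l - 1)) ^+ #|U| <=
               expR (#|U|%:R * (p ^+ 2 * (expR l - 1))).
Proof.
apply: expX_ge; have := mulr_ge0 (sqr_ge0 p) (expR_ge0 l).
have /andP[? ?] := p01; have : p ^+ 2 <= 1 by rewrite expr_le1.
lra.
Qed.

Let markov l m k : (l * m <= l * k%:R)%R%:R <= expR (- (l * m)) * expR l ^+ k :> R.
Proof.
rewrite -expRM_natr -expRD; case: (boolP (l * m <= _)) => [lm|_]; last exact: expR_ge0.
apply: (@le_trans _ _ (expR 0)); first by rewrite expR0.
by rewrite ler_expR addrC subr_ge0.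
Qed.

Lemma codeg_tail (l m : R) :
  Pr p (edge_set n) (fun G => l * m <= l * (codeg_in G x y U)%:R) <=
  expR (#|U|%:R * (p ^+ 2 * (expR l - 1)) - l * m).
Proof.
rewrite [X in _ <= expR X]addrC expRD.
apply: (@le_trans _ _ (expR (- (l * m)) * Ex p (edge_set n) (fun G => expR l ^+ codeg_in G x y U))).
  by rewrite -ExZ; apply: le_Ex => // G _; exact: markov.
by rewrite codeg_mgf ler_pM2l ?expR_gt0.
Qed.

Lemma codeg_tail_edge (l m : R) :
  Pr p (edge_set n) (fun G => ([set x; y] \in G) && (l * m <= l * (codeg_in G x y U)%:R)) <=
  p * expR (#|U|%:R * (p ^+ 2 * (expR l - 1)) - l * m).
Proof.
rewrite [X in _ * expR X]addrC expRD mulrCA.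
apply: (@le_trans _ _ (expR (- (l * m)) * Ex p (edge_set n)
    (fun G => ([set x; y] \in G)%:R * expR l ^+ codeg_in G x y U))).
  rewrite -ExZ; apply: le_Ex => // G _; rewrite mulrCA.
  case: (_ \in G) => /=; last by rewrite mul0r.
  by rewrite mul1r; exact: markov.
rewrite codeg_mgf_edge ler_pM2l ?expR_gt0 // ler_wpM2l //; by case/andP: p01.
Qed.

Lemma codeg_zero :
  Pr p (edge_set n) (fun G => codeg_in G x y U == 0%N) <= expR (- (p ^+ 2 * #|U|%:R)).
Proof.
(* [0 ^+ k] is the indicator of [k = 0], so the generating function is evaluated at 0. *)
rewrite (_ : Pr _ _ _ = (1 + p ^+ 2 * (0 - 1)) ^+ #|U|); last first.
  by rewrite -codeg_mgf; apply: eq_Ex => G _; rewrite expr0n.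
apply: (le_trans (expX_ge _ _)); last by rewrite ler_expR mulrC; lra.
have /andP[? ?] := p01; have : p ^+ 2 <= 1 by rewrite expr_le1.
lra.
Qed.

End TwoStars.

End CodegreeTails.

Section NumericBounds.
Variable R : realType.

Lemma expR1_le4 : expR 1 <= 4 :> R.
Proof.
have e0 := @expR_gt0 R (-(1/2)).
have e1 := @expR_ge1Dx R (- (1/2)).
have e2 : expR 1 * expR (- (1/2)) * expR (- (1/2)) = 1 :> R.
  by rewrite -!expRD -[RHS](@expR0 R); congr expR; lra.
have e4 : 1 <= (2 * expR (- (1/2))) * (2 * expR (- (1/2))) :> R.
  by rewrite -[leLHS]mulr1; apply: ler_pM; lra.
have := ler_wpM2l (ltW (@expR_gt0 R 1)) e4.
by rewrite mulr1; lra.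
Qed.

Lemma expRNhalf_le : expR (- (1/2)) <= 2/3 :> R.
Proof.
rewrite expRN -[2/3]invrK; rewrite lef_pV2 ?posrE ?invr_gt0 ?expR_gt0 //; try lra.
have := @expR_ge1Dx R (1/2); lra.
Qed.

Lemma expRB1_le (y : R) : 0 <= y -> y <= 1/2 -> expR y - 1 <= 2 * y.
Proof.
move=> y0 y2; have e1 := @expR_ge1Dx R (- y); have e0 := @expR_gt0 R y.
have : expR y * expR (- y) = 1 by rewrite -expRD subrr expR0.
have : expR y * (1 - y) <= expR y * expR (- y) by rewrite ler_pM2l.
nra.
Qed.

Lemma sum_set_pow (I : finType) (x : R) : \sum_(A : {set I}) x ^+ #|A| = (1 + x) ^+ #|I|.
Proof.
transitivity (\prod_(i : I) (x + 1)); last by rewrite prodr_const addrC cardT -cardE.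
rewrite bigA_distr; apply: eq_bigr => A _.
by rewrite -big_mkcond /= prodr_const.
Qed.

End NumericBounds.

(** * Chernoff bounds with explicit constants *)

Section Tails.
Variables (R : realType) (T : finType) (p : R).
Implicit Types E S : {set T}.
Hypothesis p01 : 0 <= p <= 1.

Lemma upper_tail E S (m : R) : S \subset E ->
  Pr p E (fun G => m <= #|G :&: S|%:R) <= expR (3 * p * #|S|%:R - m).
Proof.
move=> sS; have := binomial_tail p01 1 m sS.
rewrite (_ : Pr _ _ _ = Pr p E (fun G => m <= #|G :&: S|%:R)); last first.
  by apply: eq_Ex => G _; rewrite !mul1r.
move=> /le_trans; apply; rewrite ler_expR mul1r lerB //.
have pS : 0 <= p * #|S|%:R by rewrite mulr_ge0 //; case/andP: p01.
have := expR1_le4 R; nra.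
Qed.

(** Chernoff at [l = -1/2]: since expR (-1/2) is at most 2/3, the exponent is at most -1/3 + 1/4 =
    -1/12 times the mean. *)
Lemma lower_tail E S : S \subset E ->
  Pr p E (fun G => #|G :&: S|%:R <= p * #|S|%:R / 2) <= expR (- (p * #|S|%:R / 12)).
Proof.
move=> sS; have := binomial_tail p01 (- (1/2)) (p * #|S|%:R / 2) sS.
rewrite (_ : Pr _ _ _ = Pr p E (fun G => #|G :&: S|%:R <= p * #|S|%:R / 2)); last first.
  by apply: eq_Ex => G _; congr (nat_of_bool _)%:R; rewrite !mulNr lerN2 ler_pM2l //; lra.
move=> /le_trans; apply; rewrite ler_expR.
have pS : 0 <= p * #|S|%:R by rewrite mulr_ge0 //; case/andP: p01.
have := expRNhalf_le R; nra.
Qed.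

End Tails.

(** * Failure probabilities of the regularity conditions *)

Section RandomGraph.
Variables (R : realType) (n : nat) (p N : R).
Hypotheses (NE : N = n%:R) (n4 : (4 <= n)%N) (p01 : 0 <= p <= 1).
Implicit Types (G : {set {set 'I_n}}) (x y z v : 'I_n) (A U : {set 'I_n}).
Local Notation d := (N * p).
Local Notation q := (N * p ^+ 2).
Local Notation PrG := (Pr p (edge_set n)).

Let p0 : 0 <= p. Proof. by case/andP: p01. Qed.
Let p1 : p <= 1. Proof. by case/andP: p01. Qed.
Let d0 : 0 <= d. Proof. by rewrite NE mulr_ge0 ?ler0n. Qed.
Let N4 : 4 <= N. Proof. by rewrite NE ler_nat. Qed.
Let q0 : 0 <= q. Proof. by rewrite NE mulr_ge0 ?ler0n ?sqr_ge0. Qed.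

Lemma card_setC1_star v : #|star v (~: [set v])| = n.-1.
Proof.
rewrite card_star ?inE ?eqxx // cardsC1 card_ord //.
Qed.

Let Nm1 : (n.-1)%:R = N - 1.
Proof. by rewrite NE -subn1 natrB //; apply: leq_trans n4. Qed.

Lemma nbr_star G v : G \subset edge_set n -> #|G :&: star v (~: [set v])| = #|nbr G v|.
Proof.
move=> sG; rewrite cardI_star ?inE ?eqxx //; congr #|pred_of_set _|.
apply/setIidPl/subsetP => x; rewrite !inE => /(edge_neq sG).
by rewrite eq_sym.
Qed.

Lemma Pr_small_degree :
  PrG (fun G => [exists v, #|nbr G v|%:R <= d / 4]) <= N * expR (- (d / 16)).
Proof.
rewrite (_ : Pr _ _ _ = PrG (fun G => [exists v, true && (#|G :&: star v (~: [set v])|%:R <= d /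
  4)])); last first.
  apply: eq_Ex => G sG; congr (nat_of_bool _)%:R; apply: eq_existsb => v /=.
  by rewrite nbr_star.
rewrite [X in _ <= X * _](_ : N = #|predT : pred 'I_n|%:R); last first.
  by rewrite NE cardT -cardE card_ord.
apply: (Pr_exists_le p01) => v _.
have sS : star v (~: [set v]) \subset edge_set n by apply: star_sub; rewrite !inE eqxx.
have := lower_tail p01 sS; rewrite card_setC1_star Nm1 => h.
have pp := p0; have pN : 0 <= p * (N - 4) by rewrite mulr_ge0 // subr_ge0.
(* A vertex has only n - 1 possible neighbours; [4 <= N] absorbs the difference in both
   inequalities. *)
have le1 : d / 4 <= p * (N - 1) / 2 by lra.
have le2 : d / 16 <= p * (N - 1) / 12 by lra.
apply: le_trans (Pr_mono p01 _) (le_trans h _) => [G _ /le_trans|]; first exact.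
by rewrite ler_expR lerN2.
Qed.

(** Chernoff at [l = 1]: the mean is at most [q] and e - 1 <= 3, so the threshold [7 * q] leaves the
    exponent 3 - 7 = -4. *)
Lemma Pr_large_codegree :
  PrG (fun G => [exists u : 'I_n * 'I_n, (u.1 != u.2) && (7 * q <= (codeg G u.1 u.2)%:R)])
  <= N ^+ 2 * expR (- (4 * q)).
Proof.
apply: (le_trans (Pr_exists_le p01 (c := expR (- (4 * q))) _)) => /= [[x y] /= xy|]; last first.
  rewrite ler_pM2r ?expR_gt0 // NE -natrX ler_nat; apply: (leq_trans (max_card _)).
  by rewrite card_prod !card_ord mulnn.
have [xU yU] : x \notin ~: [set x; y] /\ y \notin ~: [set x; y].
  by rewrite !inE !eqxx ?orbT.
have := codeg_tail xy xU yU p01 1 (7 * q).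
rewrite (_ : Pr _ _ _ = PrG (fun G => 7 * q <= (codeg G x y)%:R)); last first.
  apply: eq_Ex => G sG; by rewrite !mul1r codeg_in_setC.
move=> /le_trans; apply; rewrite ler_expR mul1r.
have UN : #|~: [set x; y]|%:R * (p ^+ 2 * (expR 1 - 1)) <= N * (p ^+ 2 * (expR 1 - 1)).
  have e1 : 0 <= expR 1 - 1 :> R by have := @expR_ge1Dx R 1; lra.
  rewrite ler_wpM2r ?mulr_ge0 ?sqr_ge0 //.
  by rewrite NE ler_nat (leq_trans (max_card _)) ?card_ord.
have : q * (expR 1 - 1) <= q * 3 by rewrite ler_wpM2l // lerBlDr; have := expR1_le4 R; lra.
rewrite mulrA in UN; lra.
Qed.

(* The exponential rate [1 - expR (- l) - l * eta] tends to 1 when [l] is large and [eta] small. *)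
Lemma Pr_small_codegree (l eta : R) : 0 <= l ->
  PrG (fun G => [exists u : 'I_n * 'I_n,
     (u.1 != u.2) && (([set u.1; u.2] \in G) && ((codeg G u.1 u.2)%:R <= eta * q))])
  <= N ^+ 2 * (p * expR (l * eta * q - (1 - expR (- l)) * (N - 2) * p ^+ 2)).
Proof.
move=> l0; set c := p * _; have c0 : 0 <= c by rewrite mulr_ge0 ?expR_ge0.
apply: (le_trans (Pr_exists_le p01 (c := c) _)) => /= [[x y] /= xy|]; last first.
  rewrite ler_wpM2r // NE -natrX ler_nat; apply: (leq_trans (max_card _)).
  by rewrite card_prod !card_ord mulnn.
have [xU yU] : x \notin ~: [set x; y] /\ y \notin ~: [set x; y].
  by rewrite !inE !eqxx ?orbT.
have := codeg_tail_edge xy xU yU p01 (- l) (eta * q).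
have UN : #|~: [set x; y]|%:R = N - 2.
  by rewrite cardsCs setCK cards2 xy card_ord NE natrB //; apply: leq_trans n4.
rewrite UN => h; apply: le_trans (Pr_mono p01 _) (le_trans h _) => [G sG /andP[-> le]|] /=.
  by rewrite !mulNr lerN2 ler_wpM2l // -codeg_in_setC.
by rewrite /c ler_wpM2l // ler_expR; lra.
Qed.

(* A factor [expR (- (4 * M))] per vertex of [A] beats the at most [n] choices of this vertex. *)
Lemma Pr_dense_set (M l tau theta : R) : 0 <= M -> 0 <= l -> 9 <= l * tau ->
  theta * expR l <= 1 -> 0 <= theta -> N * expR (- (4 * M)) <= 1/2 ->
  PrG (fun G => [exists A : {set 'I_n}, (p * #|A|%:R <= theta * M) &&
      (tau * #|A|%:R * M < (edges_between G A A)%:R)]) <= 2 * (N * expR (- (4 * M))).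
Proof.
move=> M0 l0 lt te th0 NM.
set x := expR (- (4 * M)).
have x0 : 0 < x by exact: expR_gt0.
apply: (le_trans (Pr_exists p01 _ _ _)).
apply: (@le_trans _ _ (\sum_(A : {set 'I_n} | A != set0) x ^+ #|A|)).
  rewrite (bigID (fun A : {set 'I_n} => A == set0)) /= big1 ?add0r; last first.
    (* The strict inequality fails for the empty set, so only nonempty [A] contribute. *)
    move=> A /andP[_ /eqP ->]; apply/eqP; rewrite eq_le Pr_ge0 // andbT.
    apply: Ex_le => // G _; rewrite /edges_between big_set0 cards0 mulr0 mul0r ltxx.
    exact: lexx.
  rewrite [leRHS](bigID (fun A : {set 'I_n} => p * #|A|%:R <= theta * M)) /=.
  rewrite -[leLHS]addr0; apply: lerD; last by apply: sumr_ge0 => A _; rewrite exprn_ge0 ?ltW.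
  rewrite (eq_bigl (fun A : {set 'I_n} => (A != set0) && (p * #|A|%:R <= theta * M))); last first.
    by move=> A; rewrite andbC.
  apply: ler_sum => A /andP[_ Ath].
  have := binomial_tail p01 l (tau * #|A|%:R * M / 2) (clique_sub A).
  set X := Pr _ _ _; set Y := Pr _ _ _ => h; apply: (@le_trans _ _ X).
    apply: Pr_mono => // G sG; rewrite cardI_clique // -mul2n natrM => lt2.
    by rewrite ler_wpM2l //; lra.
  apply: (le_trans h); rewrite /x -expRM_natl ler_expR.
  have el0 : 0 <= expR l - 1 by have := @expR_ge1Dx R l; lra.
  have cA : 2 * #|clique A|%:R <= #|A|%:R ^+ 2 :> R.
    by rewrite -natrX -natrM ler_nat mul2n card_clique.
  have a0 : 0 <= #|A|%:R :> R by [].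
  (* At most |A|^2 / 2 pairs, [p * #|A| <= theta * M] and [theta * expR l <= 1]: this part of the
     exponent is at most |A| M / 2. The other part is at least 9 |A| M / 2 by [s2], which leaves -4
     |A| M. *)
  have s1 : 2 * (p * #|clique A|%:R * (expR l - 1)) <= #|A|%:R * M.
    apply: (@le_trans _ _ (p * #|A|%:R ^+ 2 * (expR l - 1))).
      rewrite [leLHS](_ : _ = p * (2 * #|clique A|%:R) * (expR l - 1)); last by ring.
      by rewrite ler_wpM2r // ler_wpM2l.
    apply: (@le_trans _ _ (#|A|%:R * (theta * M) * (expR l - 1))).
      by rewrite ler_wpM2r // expr2 mulrCA ler_wpM2l.
    rewrite -!mulrA ler_wpM2l // mulrCA -[leRHS]mulr1 ler_wpM2l //.
    by apply: le_trans te; rewrite ler_wpM2l //; lra.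
  have s2 : 9 * (#|A|%:R * M) <= l * tau * (#|A|%:R * M).
    by rewrite ler_wpM2r // mulr_ge0.
  lra.
have -> : \sum_(A : {set 'I_n} | A != set0) x ^+ #|A| = (1 + x) ^+ n - 1.
  rewrite -[n in RHS]card_ord -sum_set_pow [in RHS](bigD1 set0) //= cards0 expr0.
  by rewrite addrAC subrr add0r.
apply: (le_trans (lerB (expX_ge _ _) (lexx _))); first by lra.
rewrite -NE.
by apply: expRB1_le => //; rewrite NE mulr_ge0 // ltW.
Qed.

(** After the star at [v] is exposed, [nbr G v] is fixed and its inner edges are fresh. The
    complement of [A] in it has at least d / 8 vertices, so the mean is at least q |A| / 8; half of
    it is the threshold, and the lower tail has rate p (theta d) (d / 8) / 12 = theta q d / 96. *)
Lemma Pr_bad_link (theta : R) : 0 <= theta ->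
  PrG (fun G => [exists v, [exists A : {set 'I_n}, [&& A \subset nbr G v, theta * d <= #|A|%:R,
     (#|A|.*2 <= #|nbr G v|)%N, d / 4 <= #|nbr G v|%:R &
     (edges_between G A (nbr G v :\: A))%:R <= q * #|A|%:R / 16]]])
  <= N * (expR d * expR (- (theta * q * d / 96))).
Proof.
move=> th0.
rewrite [X in _ <= X * _](_ : N = #|predT : pred 'I_n|%:R); last first.
  by rewrite NE cardT -cardE card_ord.
apply: (le_trans _ (Pr_exists_le p01 (J := predT)
   (F := fun v G => [exists A : {set 'I_n}, [&& A \subset nbr G v, theta * d <= #|A|%:R,
     (#|A|.*2 <= #|nbr G v|)%N, d / 4 <= #|nbr G v|%:R &
     (edges_between G A (nbr G v :\: A))%:R <= q * #|A|%:R / 16]]) _)); first exact: lexx.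
move=> v _; set P := fun G : {set {set 'I_n}} => _.
have vv : v \notin ~: [set v] by rewrite !inE eqxx.
set St := star v (~: [set v]); set Re := edge_set n :\: St.
have sSt : St \subset edge_set n by exact: star_sub.
have dis : [disjoint St & Re].
  by rewrite disjoints_subset; apply/subsetP => e eS; rewrite !inE eS.
have EU : edge_set n = St :|: Re.
  by apply/setP => e; rewrite !inE; case: (boolP (e \in St)) => // /(subsetP sSt); rewrite inE.
rewrite /Pr EU ExU //.
set b := expR (- _).
(* The union over [A] costs 2 to the degree of [v], whose expectation [(1 + p) ^+ n.-1] is at most
   [expR d]. *)
apply: (@le_trans _ _ (Ex p St (fun G1 => b * 2 ^+ #|G1 :&: St|))); last first.
  rewrite ExZ Ex_pow // mulrC ler_wpM2r ?expR_ge0 // /St card_setC1_star.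
  rewrite (_ : 1 - p + p * 2 = 1 + p); last by ring.
  have pp := p0; apply: (le_trans (expX_ge _ _)); first lra.
  by rewrite ler_expR Nm1 ler_wpM2r //; lra.
apply: le_Ex => // G1 sG1.
have G1sub : G1 \subset edge_set n by exact: subset_trans sG1 sSt.
have nb G2 : G2 \subset Re -> nbr (G1 :|: G2) v = nbr G1 v.
  move=> sG2; apply/setP => x; rewrite !inE.
  case: (boolP ([set v; x] \in G2)) => [e2|]; rewrite ?orbF ?orbT //.
  have := subsetP sG2 _ e2; rewrite !inE mem_star !inE eqxx /= cards2.
  by rewrite [x == v]eq_sym; case: (v == x).
set B := nbr G1 v.
have vB : v \notin B by rewrite inE; apply/negP => /(edge_neq G1sub); rewrite eqxx.
apply: (@le_trans _ _ (\sum_(A in powerset B) b)); last first.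
  by rewrite sumr_const card_powerset nbr_star // -(mulr_natr b) natrX.
apply: (@le_trans _ _ (Ex p Re (fun G2 => \sum_(A in powerset B)
   ([&& theta * d <= #|A|%:R,
     (#|A|.*2 <= #|B|)%N, d / 4 <= #|B|%:R &
     (edges_between G2 A (B :\: A))%:R <= q * #|A|%:R / 16])%:R))).
  apply: le_Ex => // G2 sG2; rewrite /P /=; case: existsP => [[A]|_]; last by rewrite sumr_ge0.
  rewrite nb // -/B => /and5P[AB h1 h2 h3 h4].
  have h5 : (edges_between G2 A (B :\: A))%:R <= q * #|A|%:R / 16.
    apply: le_trans h4; rewrite ler_nat leq_sum // => x xA; apply: subset_leq_card.
    by apply: setSI; apply/subsetP => y; rewrite !inE => ->; rewrite orbT.
  rewrite (bigD1 A) /=; last by rewrite powersetE.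
  by rewrite h1 h2 h3 h5 /= lerDl sumr_ge0.
rewrite Ex_sum; apply: ler_sum => A; rewrite powersetE => AB.
have [/and3P[h1 h2 h3]|h] := boolP [&& theta * d <= #|A|%:R, (#|A|.*2 <= #|B|)%N & d / 4 <=
  #|B|%:R]; last first.
  apply: (le_trans (Ex_le p01 (c := 0) _)); last exact: expR_ge0.
  move=> G2 _; suff -> : [&& theta * d <= #|A|%:R, (#|A|.*2 <= #|B|)%N, d / 4 <= #|B|%:R &
     (edges_between G2 A (B :\: A))%:R <= q * #|A|%:R / 16] = false by [].
  by apply: contraNF h => /and4P[-> -> ->].
rewrite h1 h2 h3 /=.
set C := B :\: A; have dAC : [disjoint A & C].
  by rewrite disjoints_subset; apply/subsetP => x xA; rewrite !inE xA.
have cC : #|B|%:R = #|A|%:R + #|C|%:R :> R.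
  by rewrite -natrD; congr _%:R; rewrite /C -(cardsID A B) (setIidPr AB).
have c2 : 2 * #|A|%:R <= #|B|%:R :> R by rewrite -natrM mul2n ler_nat.
have C8 : d / 8 <= #|C|%:R by lra.
pose S := fan A (fun=> C).
have cS : #|S|%:R = #|A|%:R * #|C|%:R :> R.
  by rewrite /S (card_fan dAC) // sum_nat_const natrM.
have sS : S \subset Re.
  apply/subsetP => e /imsetP[[x y]]; rewrite !inE /= => /and3P[xA yA yB] ->.
  have xB := subsetP AB _ xA.
  rewrite mem_star !inE cards2.
  have /negbTE-> : x != v by apply: contraNneq vB => <-.
  have /negbTE-> : y != v by apply: contraNneq vB => <-; rewrite inE.
  by rewrite /= (_ : x != y) //; apply: contraNneq yA => <-.
have := binomial_tail p01 (- (1/2)) (p * #|S|%:R / 2) sS.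
rewrite cS => h; apply: (le_trans _ (le_trans h _)).
  apply: Pr_mono => // G2 _ le; rewrite !mulNr lerN2 ler_pM2l; last lra.
  rewrite (cardI_fan _ dAC) //; apply: (le_trans le).
  have -> : q * #|A|%:R / 16 = p * #|A|%:R * (d / 8) / 2 by field.
  by rewrite ler_pM2r ?invr_gt0 // -mulrA ler_wpM2l // ler_wpM2l.
rewrite ler_expR.
have s0 : 0 <= #|A|%:R * #|C|%:R :> R by rewrite mulr_ge0.
have : theta * d * (d / 8) <= #|A|%:R * #|C|%:R.
  by have dd := d0; apply: ler_pM => //; [rewrite mulr_ge0 | rewrite divr_ge0].
move=> /(ler_wpM2l p0); have -> : p * (theta * d * (d / 8)) = theta * q * d / 8.
  by field.
have := ler_wpM2l (mulr_ge0 p0 s0) (expRNhalf_le R); lra.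
Qed.

End RandomGraph.

(** * Every cocycle is close to a cut *)

Section Extension.
Variables (n : nat) (W X : {set 'I_n}).
Implicit Types (G F f : {set {set 'I_n}}) (x y z v : 'I_n).
Local Notation Y := (~: (W :|: X)).

Definition touch (U : {set 'I_n}) : {set {set 'I_n}} :=
  [set e in edge_set n | e :&: U != set0].

Lemma touch_sub U : touch U \subset edge_set n.
Proof. by apply/subsetP => e; rewrite inE => /andP[]. Qed.

Lemma mem_touch U x y : ([set x; y] \in touch U) = (x != y) && ((x \in U) || (y \in U)).
Proof.
rewrite !inE cards2 eqSS eqb1; case: (x != y) => //=.
apply/set0Pn/orP => [[z]|[xU|yU]].
- by rewrite !inE => /andP[/orP[]/eqP-> ?]; [left | right].
- by exists x; rewrite !inE eqxx.
- by exists y; rewrite !inE eqxx orbT.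
Qed.

Lemma card_touch U : (#|touch U| <= #|U| * n)%N.
Proof.
apply: (@leq_trans #|uedges (finset.setX U [set: 'I_n])|); last first.
  by rewrite (leq_trans (card_uedges_le _)) // cardsX cardsT card_ord.
apply: subset_leq_card; apply/subsetP => e; rewrite inE => /andP[].
rewrite inE => /cards2P[x [y [xy ->]]] /set0Pn[z]; rewrite !inE.
move=> /andP[/orP[]/eqP-> zU]; apply/imsetP.
  by exists (x, y); rewrite // !inE zU.
by exists (y, x); rewrite ?inE ?zU // /uedge setUC.
Qed.

Definition common G x y : {set 'I_n} := nbr G x :&: nbr G y :&: W.

Definition uncovered G : {set 'I_n * 'I_n} :=
  [set u | [&& u.1 != u.2, u.1 \notin W, u.2 \notin W & codeg_in G u.1 u.2 W == 0%N]].

(* For a cocycle labelled by [f] on [touch W], the label of [x y] if this is an edge and [x], [y]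
   have a common neighbour in [W]; the junk value [false] otherwise. *)
Definition forced G f x y : bool :=
  if [pick w in common G x y] is Some w then ([set x; w] \in f) (+) ([set y; w] \in f)
  else false.

Lemma forced_diag G f x : forced G f x x = false.
Proof. by rewrite /forced; case: pickP => // w _; rewrite addbb. Qed.

Lemma forcedE G F x y : G \subset edge_set n -> cocycle G F -> [set x; y] \in G ->
  x \notin W -> y \notin W -> (x, y) \notin uncovered (G :&: touch W) ->
  ([set x; y] \in F) = forced (G :&: touch W) (F :&: touch W) x y.
Proof.
move=> sG cF xyG xW yW; have xy := edge_neq sG xyG.
rewrite inE /= xy xW yW /= /codeg_in cards_eq0 => ne; rewrite /forced.
case: pickP => [w|no]; last first.
  by case/negP: ne; apply/eqP/setP => w; rewrite [RHS]inE -(no w).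
rewrite !in_setI ![_ \in nbr _ _]inE !in_setI => /andP[/andP[/andP[xw xwt] /andP[yw ywt]] wW].
have := cF _ _ _ xyG yw xw; move: xwt ywt; rewrite !mem_touch.
move=> /andP[xw' _] /andP[yw' _]; rewrite xw' yw' wW !orbT !andbT.
by case: (_ \in F); case: (_ \in F); case: (_ \in F).
Qed.

(** The third vertices of odd triples: all three labels are forced and sum to 1. If a cocycle
    induces [f], the three pairs cannot all be edges. *)
Definition defect G f x y : {set 'I_n} :=
  [set z in Y | [&& y \in Y, (x, y) \notin uncovered G, (x, z) \notin uncovered G,
     (y, z) \notin uncovered G & forced G f x y (+) forced G f x z (+) forced G f y z]].

Lemma defect_sub G f x y : defect G f x y \subset Y.
Proof. by apply/subsetP => z; rewrite inE => /andP[]. Qed.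

Lemma defect_neq G f x y z : z \in defect G f x y -> y != z.
Proof.
rewrite inE => /andP[_ /and5P[_ _ _ _]]; apply: contraTneq => ->.
by rewrite forced_diag addbb.
Qed.

Lemma defect_nonedge G F x y z : G \subset edge_set n -> cocycle G F -> x \in X ->
  [disjoint W & X] ->
  z \in defect (G :&: touch W) (F :&: touch W) x y ->
  [set x; y] \in G -> [set x; z] \in G -> [set y; z] \notin G.
Proof.
move=> sG cF xX dWX; rewrite !(in_set _ z) => /andP[zY /and5P[yY xy xz yz odd]] Gxy Gxz.
apply: contraTN odd => Gyz.
have xW : x \notin W by rewrite (disjointFl dWX).
move: zY yY; rewrite !inE !negb_or => /andP[zW _] /andP[yW _].
rewrite -!forcedE //; have := cF _ _ _ Gxy Gyz Gxz.
by case: (_ \in F); case: (_ \in F); case: (_ \in F).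
Qed.

(** The pairs on which the cut read off from the pivot [x], with [y] on the side [forced G f x y],
    is not known to agree with the cocycle. *)
Definition exceptional G f x : {set {set 'I_n}} :=
  uedges [set u : 'I_n * 'I_n | [&& u.1 \in Y, u.2 \in Y, u.1 != u.2 &
    [|| u \in uncovered G, (x, u.1) \in uncovered G, (x, u.2) \in uncovered G |
        u.2 \in defect G f x u.1]]].

Lemma exceptional_sub G f x : exceptional G f x \subset edge_set n :\: touch (W :|: X).
Proof.
apply/subsetP => e /imsetP[[y z]]; rewrite in_set /= => /and4P[yY zY yz _] ->.
by rewrite in_setD mem_touch yz negb_or -!in_setC yY zY inE cards2 yz.
Qed.

Definition uncovered_nbr G x : {set 'I_n} := [set y in Y | (x, y) \in uncovered G].

Lemma card_exceptional G f x :
  (#|exceptional G f x| <= #|uncovered G| + #|uncovered_nbr G x| * n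
     + #|uncovered_nbr G x| * n + \sum_(y in Y) #|defect G f x y|)%N.
Proof.
apply: (leq_trans (card_uedges_le _)).
set P1 := uncovered G; set P2 := finset.setX (uncovered_nbr G x) [set: 'I_n].
set P3 := finset.setX [set: 'I_n] (uncovered_nbr G x).
set P4 := [set u : 'I_n * 'I_n | (u.1 \in Y) && (u.2 \in defect G f x u.1)].
apply: (@leq_trans #|P1 :|: P2 :|: P3 :|: P4|).
  apply: subset_leq_card; apply/subsetP => -[y z]; rewrite in_set /= => /and4P[y1 y2 _].
  case/or4P => h; rewrite !in_setU !in_setX !in_setT [_ \in P4]in_set /= ?andbT.
  - by rewrite h.
  - by rewrite [y \in uncovered_nbr _ _]in_set y1 h !orbT.
  - by rewrite [z \in uncovered_nbr _ _]in_set y2 h !orbT.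
  - by rewrite y1 h !orbT.
apply: (leq_trans (leq_card_setU _ _)); apply: leq_add; last by rewrite sum_card_pairs.
apply: (leq_trans (leq_card_setU _ _)); apply: leq_add; last first.
  by rewrite cardsX cardsT card_ord mulnC.
apply: (leq_trans (leq_card_setU _ _)); apply: leq_add => //.
by rewrite cardsX cardsT card_ord.
Qed.

(** At a non-exceptional edge [y z] inside [Y] the label is the forced one, and this is the sum of
    the labels forced on [x y] and [x z], as in a cut. The double reflects that [resid_size] counts
    edges from both ends. *)
Lemma resid_exceptional G F x : G \subset edge_set n -> cocycle G F -> x \in X ->
  [disjoint W & X] ->
  (resid_size G F [set y in Y | forced (G :&: touch W) (F :&: touch W) x y] <=
   (#|G :&: exceptional (G :&: touch W) (F :&: touch W) x| +
    #|G :&: touch (W :|: X)|).*2)%N.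
Proof.
move=> sG cF xX dWX; set g := forced _ _; set h := [set y in Y | _].
pose P := [set u : 'I_n * 'I_n | u.2 \in resid G F h u.1].
have -> : resid_size G F h = #|P|.
  rewrite /resid_size; have := sum_card_pairs (resid G F h) [set: 'I_n].
  rewrite (eq_bigl xpredT) => [->|v]; last by rewrite inE.
  by apply: eq_card => u; rewrite !inE.
apply: (leq_trans (card_uedges_ge _)); rewrite leq_double.
apply: leq_trans (leq_card_setU _ _); apply: subset_leq_card.
apply/subsetP => e /imsetP[[y z]]; rewrite in_set /= in_set => /andP[].
rewrite in_set => yzG odd ->; have yz := edge_neq sG yzG.
rewrite /uedge /= in_setU !in_setI yzG /= mem_touch yz /= orbC -implyNb negb_or.
apply/implyP => /andP[yY zY].
have yY' : y \in Y by rewrite in_setC.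
have zY' : z \in Y by rewrite in_setC.
apply/imsetP; exists (y, z) => //; rewrite in_set /= yY' zY' yz /=.
have xW : x \notin W by rewrite (disjointFl dWX).
have [yW zW] : y \notin W /\ z \notin W.
  by move: yY zY; rewrite !inE !negb_or => /andP[-> _] /andP[-> _].
set G1 := G :&: touch W.
case: (boolP ((y, z) \in uncovered G1)) => //= n1.
case: (boolP ((x, y) \in uncovered G1)) => //= n2.
case: (boolP ((x, z) \in uncovered G1)) => //= n3.
rewrite in_set zY' yY' n1 n2 n3 /=; move: odd.
rewrite (forcedE sG cF yzG yW zW n1) -/g [y \in h]in_set [z \in h]in_set yY' zY' /=.
by case: (g y z); case: (g x y); case: (g x z).
Qed.

End Extension.

(** * Edges away from W: consequences of being far from every cut *)

Section SecondExposure.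
Variables (R : realType) (n : nat) (W X : {set 'I_n}) (p s : R).
Implicit Types (G F f : {set {set 'I_n}}) (x y z : 'I_n).
Local Notation Y := (~: (W :|: X)).
Hypothesis dWX : [disjoint W & X].

Definition rest : {set {set 'I_n}} := edge_set n :\: touch W.

Definition defect_large G1 f x : {set 'I_n} :=
  [set y in Y | s <= #|defect W X G1 f x y|%:R].

(** The nested option lists the n + 2 possibilities at one pivot, so that the union bound over [c]
    has at most (n + 2)^n terms. *)
Definition target G1 f (c : {ffun 'I_n -> option (option 'I_n)}) x : {set 'I_n} :=
  match c x with
  | None => set0
  | Some None => defect_large G1 f x
  | Some (Some y) => defect W X G1 f x y
  end.

Definition chosen (c : {ffun 'I_n -> option (option 'I_n)}) : {set 'I_n} :=
  [set x in X | c x != None].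

Definition target_fan G1 f c := fan (chosen c) (target G1 f c).

Definition admissible G1 f (j : R) c : bool :=
  (j <= #|chosen c|%:R) && [forall x in chosen c, s <= #|target G1 f c x|%:R].

(** The pairs that have to be non-edges for a cocycle inducing [f]: the other two sides of an odd
    triple are already edges. *)
Definition covered G1 f G2 : {set 'I_n * 'I_n} :=
  [set u | [exists x in X, [&& [set x; u.1] \in G2, [set x; u.2] \in G2 &
     u.2 \in defect W X G1 f x u.1]]].

Definition bad_exceptional (a b : R) G1 f G2 : bool :=
  [exists x, (x \in X) && ((#|exceptional W X G1 f x|%:R <= a) &&
     (b <= #|G2 :&: exceptional W X G1 f x|%:R))].

(* If too many x have too few neighbours in [defect_large G1 f x] or in some [defect W X G1 f x y],
   a choice [c] of one such set for each of them makes a single binomial variable too small. *)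
Definition bad_fan (j : R) G1 f G2 : bool :=
  [exists c, admissible G1 f j c &&
     (#|G2 :&: target_fan G1 f c|%:R <= p * #|target_fan G1 f c|%:R / 2)].

Definition bad_covered (r : R) G1 f G2 : bool :=
  (r <= #|covered G1 f G2|%:R) && (G2 :&: uedges (covered G1 f G2) == set0).

Lemma target_sub G1 f c x : target G1 f c x \subset Y.
Proof.
rewrite /target; case: (c x) => [[y|]|]; rewrite ?sub0set ?defect_sub //.
by apply/subsetP => y; rewrite inE => /andP[].
Qed.

Lemma disjoint_chosen c : [disjoint chosen c & Y].
Proof.
rewrite disjoints_subset; apply/subsetP => x; rewrite !inE => /andP[-> _].
by rewrite orbT.
Qed.

Lemma restE x y : x \in X -> y \in Y -> [set x; y] \in rest.
Proof.
move=> xX yY; have xW : x \in W = false by rewrite (disjointFl dWX).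
move: yY; rewrite in_setC in_setU negb_or => /andP[yW yX].
have xy : x != y by apply: contraNneq yX => <-.
by rewrite in_setD mem_touch xW (negbTE yW) andbF inE cards2 xy.
Qed.

Lemma target_fan_sub G1 f c : target_fan G1 f c \subset rest.
Proof.
apply/subsetP => e /imsetP[[x y]]; rewrite in_set /= => /andP[xc yt] ->.
apply: restE; last exact: subsetP (target_sub _ _ _ _) _ yt.
by move: xc; rewrite inE => /andP[].
Qed.

Lemma card_target_fan G1 f c :
  #|target_fan G1 f c| = (\sum_(x in chosen c) #|target G1 f c x|)%N.
Proof. exact/(card_fan (disjoint_chosen c))/target_sub. Qed.

Lemma cardI_target_fan G G1 f c :
  #|G :&: target_fan G1 f c| = (\sum_(x in chosen c) #|nbr G x :&: target G1 f c x|)%N.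
Proof. exact/(cardI_fan _ (disjoint_chosen c))/target_sub. Qed.

(** If fewer than [j] pivots of [X'] were good, more than [j] would fail. Let [c] select for each of
    these a set in which it has too few neighbours: this is admissible and its fan is too thin. *)
Lemma many_good_vertices G G1 f (j : R) (X' : {set 'I_n}) : 0 <= j -> X' \subset X ->
  2 * j <= #|X'|%:R -> {in X', forall x, s <= #|defect_large G1 f x|%:R} ->
  ~~ bad_fan j G1 f (G :&: rest) ->
  j <= #|[set x in X' |
    (p * #|defect_large G1 f x|%:R / 2 < #|nbr G x :&: defect_large G1 f x|%:R) &&
    [forall y in defect_large G1 f x,
      p * #|defect W X G1 f x y|%:R / 2 < #|nbr G x :&: defect W X G1 f x y|%:R]]|%:R.
Proof.
move=> j0 sX X'2 X'D nb; set Gd := [set x in X' | _].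
rewrite leNgt; apply/negP => ltj; case/negP: nb.
pose c := [ffun x => if x \in X' :\: Gd then
  (if #|nbr G x :&: defect_large G1 f x|%:R <= p * #|defect_large G1 f x|%:R / 2 then Some None
   else if [pick y in defect_large G1 f x |
          #|nbr G x :&: defect W X G1 f x y|%:R <= p * #|defect W X G1 f x y|%:R / 2]
        is Some y then Some (Some y) else None) else None].
have cE x : x \in X' :\: Gd -> [/\ c x != None, s <= #|target G1 f c x|%:R &
    #|nbr G x :&: target G1 f c x|%:R <= p * #|target G1 f c x|%:R / 2].
  move=> xB; have [xX xG] : x \in X' /\ x \notin Gd by move: xB; rewrite in_setD => /andP[].
  rewrite /target /c ffunE xB; case: leP => [le1|lt1]; first by split => //; exact: X'D.
  case: pickP => [y /andP[yD le2]|no].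
    by split=> //; move: yD; rewrite inE => /andP[].
  case/negP: xG; rewrite inE xX lt1 /=; apply/forall_inP => y yD.
  by rewrite ltNge; have /= := no y; rewrite yD /= => ->.
have chE : chosen c = X' :\: Gd.
  apply/setP => x; rewrite inE; case: (boolP (x \in X' :\: Gd)) => [xB|xB].
    have [-> _ _] := cE _ xB; rewrite andbT; apply: (subsetP sX).
    by move: xB; rewrite in_setD => /andP[].
  by rewrite /c ffunE (negbTE xB) eqxx andbF.
apply/existsP; exists c; apply/andP; split.
  apply/andP; split; last by apply/forall_inP => x; rewrite chE => /cE[].
  rewrite chE.
  have : #|X'|%:R = #|Gd|%:R + #|X' :\: Gd|%:R :> R.
    rewrite -natrD -(cardsID Gd X') (setIidPr _) //.
    by apply/subsetP => x; rewrite inE => /andP[].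
  lra.
rewrite -setIA (setIidPr (target_fan_sub _ _ _)) cardI_target_fan card_target_fan.
rewrite !natr_sum mulr_sumr mulr_suml; apply: ler_sum => x; rewrite chE => xB.
by have [_ _] := cE _ xB.
Qed.

(** Double counting: a good pivot is joined to at least p s / 2 suitable [y], and for each of them
    to at least p s / 2 suitable [z], while a pair is seen from at most as many pivots as it has
    common neighbours. *)
Lemma covered_large G G1 f (j K : R) (X' : {set 'I_n}) : 0 <= p -> 0 <= s ->
  0 <= j -> X' \subset X ->
  2 * j <= #|X'|%:R -> {in X', forall x, s <= #|defect_large G1 f x|%:R} ->
  ~~ bad_fan j G1 f (G :&: rest) ->
  (forall x y, x != y -> (codeg G x y)%:R <= K) ->
  j * (p * s / 2) ^+ 2 <= #|covered G1 f (G :&: rest)|%:R * K.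
Proof.
move=> p0 s0 j0 sX X'2 X'D nb cK; have := many_good_vertices j0 sX X'2 X'D nb.
set Gd := [set x in X' | _] => jGd.
have ps0 : 0 <= p * s / 2 by rewrite divr_ge0 ?mulr_ge0.
pose P x := [set u : 'I_n * 'I_n | [&& u.1 \in nbr G x, u.2 \in nbr G x & u.2 \in defect W X G1 f
  x u.1]].
have P_large x : x \in Gd -> (p * s / 2) ^+ 2 <= #|P x|%:R.
  rewrite inE => /andP[xX' /andP[lt1 /forall_inP lt2]].
  set D := defect_large G1 f x in lt1 lt2.
  pose Sx y := nbr G x :&: defect W X G1 f x y.
  apply: (@le_trans _ _ (\sum_(y in nbr G x :&: D) #|Sx y|)%N%:R); last first.
    rewrite ler_nat (sum_card_pairs Sx); apply: subset_leq_card; apply/subsetP => u.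
    rewrite in_set in_setI => /andP[/andP[u1 _]]; rewrite in_setI => /andP[u2 u3].
    by rewrite in_set u1 u2 u3.
  apply: (@le_trans _ _ (\sum_(y in nbr G x :&: D) (p * s / 2))); last first.
    rewrite natr_sum; apply: ler_sum => y; rewrite inE => /andP[_ yD].
    apply: le_trans (ltW (lt2 y yD)); rewrite ler_pM2r ?invr_gt0 // ler_wpM2l //.
    by move: yD; rewrite inE => /andP[].
  rewrite sumr_const -(mulr_natl _ #|_|) expr2; apply: ler_wpM2r => //.
  apply: le_trans (ltW lt1); rewrite ler_pM2r ?invr_gt0 // ler_wpM2l //.
  exact: X'D.
apply: (@le_trans _ _ (\sum_(x in Gd) #|P x|%:R)).
  apply: (@le_trans _ _ (\sum_(x in Gd) (p * s / 2) ^+ 2)); last exact: ler_sum.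
  by rewrite sumr_const -(mulr_natl _ #|_|); apply: ler_wpM2r => //; exact: sqr_ge0.
have GdX x : x \in Gd -> x \in X.
  by rewrite inE => /andP[xX' _]; exact: (subsetP sX).
have PC x u : x \in Gd -> u \in P x -> u \in covered G1 f (G :&: rest).
  move=> xG; rewrite in_set => /and3P[]; rewrite !(in_set (fun y => [set x; y] \in G)).
  move=> ux1 ux2 ud; rewrite in_set; apply/existsP; exists x.
  rewrite (GdX _ xG) /= in_setI in_setI ux1 ux2 ud !restE ?GdX //.
    by move: ud; rewrite inE => /andP[].
  by move: ud; rewrite inE => /andP[_ /andP[]].
apply: (@le_trans _ _ (\sum_(u in covered G1 f (G :&: rest)) (codeg G u.1 u.2)%:R)).
  rewrite -!natr_sum ler_nat.
  under eq_bigr do rewrite card_sum_mem.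
  rewrite exchange_big /= [leqRHS]big_mkcond; apply: leq_sum => u _.
  case: ifP => uC; last first.
    rewrite big1 // => x xG; case uP: (u \in P x) => //.
    by move: uC; rewrite (PC x u).
  rewrite /codeg card_sum_mem big_mkcond; apply: leq_sum => x _.
  case: (x \in Gd) => //; case: (boolP (u \in P x)) => //.
  rewrite in_set => /and3P[x1 x2 _].
  by rewrite in_setI nbrC x1 nbrC x2.
rewrite mulr_natl -sumr_const; apply: ler_sum => u; rewrite in_set => /existsP[x].
move=> /andP[_ /and3P[_ _ /defect_neq]]; exact: cK.
Qed.

Lemma near_cut_of_not_bad G F (j K a b dl r t : R) :
  G \subset edge_set n -> cocycle G F -> 0 <= p -> 0 <= s -> 0 <= j -> 0 < dl -> 0 < K ->
  let G1 := G :&: touch W in let f := F :&: touch W in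
  #|uncovered W G1|%:R <= (#|X|%:R - 2 * j) * dl ->
  #|uncovered W G1|%:R + 2 * dl * n%:R + 2 * s * n%:R <= a ->
  r * K <= j * (p * s / 2) ^+ 2 ->
  #|G :&: touch (W :|: X)|%:R <= t ->
  (forall x y, x != y -> (codeg G x y)%:R <= K) ->
  ~~ [|| bad_exceptional a b G1 f (G :&: rest), bad_fan j G1 f (G :&: rest) |
      bad_covered r G1 f (G :&: rest)] ->
  exists h, (resid_size G F h)%:R <= 2 * (b + t).
Proof.
move=> sG cF p0 s0 j0 dl0 K0 G1 f unc1 unc2 rK tG cK.
rewrite !negb_or => /and3P[nbA nbB nbC].
(* Pivots with few uncovered partners; by Markov's inequality at least [2 * j] of them exist. *)
pose X' := [set x in X | #|uncovered_nbr W X G1 x|%:R <= dl].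
have sX : X' \subset X by apply/subsetP => x; rewrite inE => /andP[].
have X'2 : 2 * j <= #|X'|%:R.
  have le1 : #|X :\: X'|%:R * dl <= #|uncovered W G1|%:R.
    apply: (@le_trans _ _ (\sum_(x in X :\: X') #|uncovered_nbr W X G1 x|)%N%:R).
      rewrite natr_sum mulr_natl -sumr_const; apply: ler_sum => x.
      by rewrite !inE => /andP[+ xX]; rewrite xX /= -ltNge => /ltW.
    rewrite ler_nat sum_card_pairs; apply: subset_leq_card; apply/subsetP => -[x y].
    by rewrite in_set /= => /andP[_]; rewrite in_set => /andP[].
  have : #|X|%:R = #|X'|%:R + #|X :\: X'|%:R :> R.
    by rewrite -natrD -(cardsID X' X) (setIidPr sX).
  have := le_trans le1 unc1; rewrite ler_pM2r //; lra.
(* Dichotomy: either some pivot has small total defect and its cut is close to [F], or all pivots of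
   [X'] have a large one and too many pairs must be non-edges. *)
case: (boolP [exists x in X', (\sum_(y in Y) #|defect W X G1 f x y|)%N%:R <= 2 * s * n%:R]).
  move=> /existsP[x /andP[xX' lex]]; have xX := subsetP sX _ xX'.
  have ex : #|exceptional W X G1 f x|%:R <= a.
    apply: le_trans unc2; have := card_exceptional W X G1 f x.
    rewrite -(ler_nat R) !natrD !natrM => /le_trans; apply.
    have : #|uncovered_nbr W X G1 x|%:R * n%:R <= dl * n%:R :> R.
      by rewrite ler_wpM2r //; move: xX'; rewrite inE => /andP[].
    lra.
  eexists; apply: (le_trans (y := (_.*2)%N%:R)).
    by rewrite ler_nat; exact: (resid_exceptional sG cF xX dWX).
  rewrite -mul2n natrM ler_pM2l // natrD lerD // leNgt; apply/negP => lt.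
  case/negP: nbA; apply/existsP; exists x; rewrite xX ex /= -setIA.
  rewrite (setIidPr (_ : _ \subset rest)); first exact: ltW.
  apply: (subset_trans (exceptional_sub _ _ _ _ _)); apply: setDS.
  apply/subsetP => e; rewrite !in_set => /andP[-> /=] /set0Pn[w].
  by rewrite in_setI => /andP[we wW]; apply/set0Pn; exists w; rewrite !inE we wW.
move=> /existsPn noA; exfalso.
have X'D : {in X', forall x, s <= #|defect_large G1 f x|%:R}.
  move=> x xX'; have := noA x; rewrite xX' /= -ltNge => lt.
  have n0 : 0 < n%:R :> R by rewrite ltr0n (leq_ltn_trans _ (ltn_ord x)).
  rewrite -(ler_pM2r n0).
  (* Averaging: a [y] with large defect contributes at most [n], any other at most [s]. *)
  have : (\sum_(y in Y) #|defect W X G1 f x y|)%N%:R <= #|defect_large G1 f x|%:R * n%:R + n%:R * s.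
    rewrite natr_sum (bigID (fun y => s <= #|defect W X G1 f x y|%:R)) /=.
    apply: lerD.
      rewrite (eq_bigl (mem (defect_large G1 f x))); last by move=> y; rewrite [RHS]in_set.
      rewrite mulr_natl -sumr_const; apply: ler_sum => y _.
      by rewrite ler_nat (leq_trans (max_card _)) // card_ord.
    apply: (@le_trans _ _ (\sum_(y : 'I_n) s)); last by rewrite sumr_const card_ord mulr_natl.
    rewrite big_mkcond; apply: ler_sum => y _; case: ifP => // /andP[_].
    by rewrite -ltNge => /ltW.
  lra.
have := covered_large p0 s0 j0 sX X'2 X'D nbB cK.
move=> /(le_trans rK); rewrite ler_pM2r // => rC.
case/negP: nbC; rewrite /bad_covered rC /=; apply/eqP/setP => e; rewrite inE [RHS]inE.
apply/negP => /andP[]; rewrite inE => /andP[eG _] /imsetP[[y z]].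
rewrite in_set => /existsP[x /andP[xX /and3P[]]] /=.
rewrite !(in_setI _ G) => /andP[xy _] /andP[xz _] zd ee.
by have := defect_nonedge sG cF xX dWX zd xy xz; rewrite -[[set y; z]]/(uedge (y, z)) -ee eG.
Qed.

End SecondExposure.

(** * Probabilities in the second exposure *)

Section SecondExposureProbability.
Variables (R : realType) (n : nat) (W X : {set 'I_n}) (p s : R).
Implicit Types (G F f : {set {set 'I_n}}) (x y z : 'I_n).
Local Notation Y := (~: (W :|: X)).
Hypotheses (dWX : [disjoint W & X]) (p01 : 0 <= p <= 1) (s0 : 0 <= s).

Let p0 : 0 <= p. Proof. by case/andP: p01. Qed.

Lemma Pr_bad_exceptional G1 f (a b : R) : 0 <= a ->
  Pr p (rest W) (bad_exceptional W X a b G1 f) <= n%:R * expR (3 * p * a - b).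
Proof.
move=> a0; apply: (le_trans (Pr_exists_le p01 (c := expR (3 * p * a - b)) _)).
  move=> x xX; case: (boolP (_ <= a)) => [le1|_] /=; last first.
    by apply: (le_trans (Ex_le p01 (c := 0) _)) => //; exact: expR_ge0.
  apply: (le_trans (upper_tail p01 b _)).
    apply: (subset_trans (exceptional_sub _ _ _ _ _)); apply: setDS.
    apply/subsetP => e; rewrite !in_set => /andP[-> /=] /set0Pn[w].
    by rewrite in_setI => /andP[we wW]; apply/set0Pn; exists w; rewrite !inE we wW.
  by rewrite ler_expR lerB // ler_wpM2l // mulr_ge0.
rewrite ler_wpM2r ?expR_ge0 // ler_nat (leq_trans (max_card _)) //.
by rewrite card_ord.
Qed.

Lemma Pr_bad_fan G1 f (j : R) : 0 <= j ->
  Pr p (rest W) (bad_fan W X p s j G1 f) <= n.+2%:R ^+ n * expR (- (p * (j * s) / 12)).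
Proof.
move=> j0; apply: (le_trans (Pr_exists_le p01 (c := expR (- (p * (j * s) / 12))) _)).
  move=> c /andP[jc /forall_inP sc].
  apply: (le_trans (lower_tail p01 (target_fan_sub s dWX _ _ _))).
  rewrite ler_expR lerN2 ler_pM2r ?invr_gt0 // ler_wpM2l // card_target_fan natr_sum.
  apply: (@le_trans _ _ (\sum_(x in chosen X c) s)).
    by rewrite sumr_const -(mulr_natl s) ler_wpM2r.
  exact: ler_sum.
rewrite ler_wpM2r ?expR_ge0 // -natrX ler_nat (leq_trans (max_card _)) //.
by rewrite card_ffun !card_option card_ord.
Qed.

Lemma covered_sub G1 f G2 :
  uedges (covered W X G1 f G2) \subset rest W :\: touch X.
Proof.
apply/subsetP => e /imsetP[[y z]]; rewrite in_set => /existsP[x /andP[_ /and3P[_ _ /= d]]] ->.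
have yz := defect_neq d; move: d; rewrite in_set => /andP[zY /andP[yY _]].
move: zY yY; rewrite !in_setC !in_setU !negb_or => /andP[zW zX] /andP[yW yX].
rewrite !in_setD !mem_touch (negbTE zW) (negbTE zX) (negbTE yW) (negbTE yX) !andbF.
by rewrite inE cards2 yz.
Qed.

Lemma covered_ext G1 f G2 G3 : G2 :|: G3 \subset edge_set n -> G3 \subset rest W :\: touch X ->
  covered W X G1 f (G2 :|: G3) = covered W X G1 f G2.
Proof.
move=> sG sG3; apply/setP => u; rewrite !in_set; apply: eq_existsb => x.
case: (boolP (x \in X)) => //= xX.
have xE y : ([set x; y] \in G2 :|: G3) = ([set x; y] \in G2).
  rewrite in_setU; case: (boolP ([set x; y] \in G3)) => e3; rewrite ?orbF //.
  have xy : x != y by apply: (edge_neq sG); rewrite in_setU e3 orbT.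
  by have := subsetP sG3 _ e3; rewrite !in_setD mem_touch xy xX.
by rewrite !xE.
Qed.

(** A further exposure: the covered pairs are determined by the edges at [X] and avoid both [W] and
    [X], so whether they are edges is still undecided. Up to two ordered pairs share an edge, hence
    24 = 2 * 12. *)
Lemma Pr_bad_covered G1 f (r : R) :
  Pr p (rest W) (bad_covered W X r G1 f) <= expR (- (p * r / 24)).
Proof.
set B := rest W :\: touch X; set A := rest W :&: touch X.
have sR : rest W \subset edge_set n by exact: subsetDl.
rewrite /Pr (_ : rest W = A :|: B); last by rewrite setID.
rewrite ExU; last first.
  by rewrite disjoints_subset; apply/subsetP => e; rewrite !in_set => /andP[_ ->].
apply: Ex_le => // G2 sG2.
have cE G3 : G3 \subset B -> covered W X G1 f (G2 :|: G3) = covered W X G1 f G2.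
  move=> sG3; apply: covered_ext => //; rewrite subUset.
  rewrite (subset_trans sG2) ?(subset_trans sG3) //.
    by apply: (subset_trans (subsetDl _ _)).
  by apply: (subset_trans (subsetIl _ _)).
set S := uedges (covered W X G1 f G2).
have [rc|rc] := leP r #|covered W X G1 f G2|%:R; last first.
  apply: (le_trans (Ex_le p01 (c := 0) _)); last exact: expR_ge0.
  by move=> G3 /cE e; rewrite /bad_covered e [r <= _]leNgt rc.
have cS : r / 2 <= #|S|%:R.
  rewrite ler_pdivrMr // -natrM; apply: le_trans rc _.
  by rewrite ler_nat muln2 card_uedges_ge.
apply: (@le_trans _ _ (expR (- (p * #|S|%:R / 12)))); last first.
  by rewrite ler_expR lerN2; have := ler_wpM2l p0 cS; lra.
apply: le_trans (lower_tail p01 (covered_sub G1 f G2)).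
apply: Pr_mono => // G3 sG3 /andP[_]; rewrite (cE _ sG3) setIUl setU_eq0 => /andP[_ /eqP->].
by rewrite cards0 divr_ge0 // mulr_ge0.
Qed.

(** Markov's inequality for the number of uncovered pairs. *)
Lemma Pr_uncovered (z : R) : 0 < z ->
  Pr p (edge_set n) (fun G => z <= #|uncovered W (G :&: touch W)|%:R) <=
  n%:R ^+ 2 * expR (- (p ^+ 2 * #|W|%:R)) / z.
Proof.
move=> z0; rewrite ler_pdivlMr //.
apply: (@le_trans _ _ (Ex p (edge_set n) (fun G => #|uncovered W (G :&: touch W)|%:R))).
  rewrite mulrC -ExZ; apply: le_Ex => // G _; case: (boolP (z <= _)) => h.
    by rewrite mulr1.
  by rewrite mulr0.
rewrite (@eq_Ex _ _ _ _ _ (fun G => \sum_u (u \in uncovered W (G :&: touch W) : nat)%:R)); last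
  first.
  by move=> G _; rewrite card_sum_mem natr_sum.
rewrite Ex_sum; apply: (@le_trans _ _ (\sum_(u : 'I_n * 'I_n) expR (- (p ^+ 2 * #|W|%:R)))).
  apply: ler_sum => -[x y] _.
  case: (boolP [&& x != y, x \notin W & y \notin W]) => [/and3P[xy xW yW]|no]; last first.
    apply: (le_trans (Ex_le p01 (c := 0) _)) => [G _|]; last exact: expR_ge0.
    case: (boolP (_ \in uncovered _ _)) => //; rewrite in_set => /and4P[/= a b c _].
    by case/negP: no; rewrite a b c.
  apply: le_trans (codeg_zero xy xW yW p01); apply: Pr_mono => // G sG.
  rewrite in_set => /and4P[_ _ _ /=]; rewrite (@codeg_in_ext _ _ G) // => w wW.
  rewrite !in_setI !mem_touch wW !orbT !andbT.
  have -> : x != w by apply: contraNneq xW => ->.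
  have -> : y != w by apply: contraNneq yW => ->.
  by rewrite !andbT.
rewrite sumr_const card_prod !card_ord -(mulr_natl _ (n * n)%N) natrM expr2.
exact: lexx.
Qed.

Definition near_cut G (c : R) : Prop := forall F, F \subset G -> cocycle G F ->
  exists h, (resid_size G F h)%:R <= c.

(** The first four terms pay for the conditions under which the deterministic argument runs. Given
    at most [m] edges at [W], the trace [f] of an unknown cocycle takes at most 2^m <= expR m
    values, and each fixed [f] is bad with small probability. *)
Lemma Pr_not_near_cut (j K a b dl r t z m : R) :
  0 < z -> 0 <= a -> 0 < dl -> 0 < K -> 0 < j ->
  z <= (#|X|%:R - 2 * j) * dl ->
  z + 2 * dl * n%:R + 2 * s * n%:R <= a -> r * K <= j * (p * s / 2) ^+ 2 ->
  Pr p (edge_set n) (fun G => ~~ `[< near_cut G (2 * (b + t)) >]) <=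
  Pr p (edge_set n) (fun G => t <= #|G :&: touch (W :|: X)|%:R) +
  (Pr p (edge_set n) (fun G => z <= #|uncovered W (G :&: touch W)|%:R) +
  (Pr p (edge_set n) (fun G => [exists u : 'I_n * 'I_n, (u.1 != u.2) && (K <= (codeg G u.1
    u.2)%:R)]) +
  (Pr p (edge_set n) (fun G => m <= #|G :&: touch W|%:R) +
  expR m * (n%:R * expR (3 * p * a - b) + n.+2%:R ^+ n * expR (- (p * (j * s) / 12)) +
            expR (- (p * r / 24)))))).
Proof.
move=> z0 a0 dl0 K0 j0 zX za rK.
pose bad G1 f G2 := [|| bad_exceptional W X a b G1 f G2, bad_fan W X p s j G1 f G2 |
   bad_covered W X r G1 f G2].
pose ex G := (#|G :&: touch W|%:R <= m) && [exists f, (f \in powerset (G :&: touch W)) &&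
   bad (G :&: touch W) f (G :&: rest W)].
apply: (le_trans (y := Pr p (edge_set n) (fun G =>
   (t <= #|G :&: touch (W :|: X)|%:R) || ((z <= #|uncovered W (G :&: touch W)|%:R) ||
   ([exists u : 'I_n * 'I_n, (u.1 != u.2) && (K <= (codeg G u.1 u.2)%:R)] ||
   ((m <= #|G :&: touch W|%:R) || ex G)))))).
  apply: Pr_mono => // G sG; apply: contraR.
  rewrite !negb_or => /and5P[h1 h2 h3 h4 nex]; apply/asboolP => F FG cF.
  move: h1 h2 h4; rewrite -!ltNge => h1 h2 h4.
  apply: (near_cut_of_not_bad (s := s) (p := p) (j := j) (K := K) (a := a) (dl := dl) (r := r)
    dWX sG cF) => //.
  - exact: ltW.
  - by apply: le_trans zX; exact: ltW.
  - by apply: le_trans za; rewrite !lerD2r; exact: ltW.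
  - exact: ltW.
  - move=> x y xy; rewrite leNgt; apply: contraNN h3 => /ltW h3.
    by apply/existsP; exists (x, y); rewrite /= xy h3.
  - apply: contraNN nex => nex; rewrite /ex (ltW h4) /=.
    by apply/existsP; exists (F :&: touch W); rewrite powersetE setSI //=; exact: nex.
apply: (le_trans (PrU p01 _ _ _)); apply: lerD => //.
apply: (le_trans (PrU p01 _ _ _)); apply: lerD => //.
apply: (le_trans (PrU p01 _ _ _)); apply: lerD => //.
apply: (le_trans (PrU p01 _ _ _)); apply: lerD => //.
set B := n%:R * _ + _ + _.
have B0 : 0 <= B.
  by rewrite !addr_ge0 ?mulr_ge0 ?expR_ge0 ?exprn_ge0.
have EU : edge_set n = touch W :|: rest W.
  apply/setP => e; rewrite in_setU in_setD.
  by case: (boolP (e \in touch W)) => // /(subsetP (touch_sub W)).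
rewrite /Pr EU ExU; last first.
  by rewrite disjoints_subset; apply/subsetP => e eT; rewrite in_setC in_setD eT.
apply: Ex_le => // G1 sG1.
have ET G2 : G2 \subset rest W -> (G1 :|: G2) :&: touch W = G1.
  move=> sG2; apply/setP => e; rewrite in_setI in_setU.
  case: (boolP (e \in G1)) => [/(subsetP sG1) ->//|_] /=.
  case: (boolP (e \in G2)) => //= /(subsetP sG2); rewrite in_setD => /andP[/negbTE->].
  by [].
have ER G2 : G2 \subset rest W -> (G1 :|: G2) :&: rest W = G2.
  move=> sG2; apply/setP => e; rewrite in_setI in_setU.
  case: (boolP (e \in G2)) => [/(subsetP sG2) ->//|_] /=; first by rewrite orbT.
  by rewrite orbF; case: (boolP (e \in G1)) => //= /(subsetP sG1) eT; rewrite in_setD eT.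
have [le1|lt1] := leP #|G1|%:R m; last first.
  apply: (le_trans (Ex_le p01 (c := 0) _)) => [G2 sG2|]; last first.
    by rewrite mulr_ge0 ?expR_ge0.
  by rewrite /ex ET // [_ <= m]leNgt lt1.
apply: (le_trans (y := Pr p (rest W) (fun G2 => [exists f, (f \in powerset G1) && bad G1 f G2]))).
  by apply: Pr_mono => // G2 sG2; rewrite /ex ET // ER // => /andP[].
apply: (le_trans (Pr_exists_le p01 (c := B) _)) => [f _|].
  apply: (le_trans (PrU p01 _ _ _)); rewrite /B -addrA; apply: lerD.
    exact: Pr_bad_exceptional.
  apply: (le_trans (PrU p01 _ _ _)); apply: lerD; last exact: Pr_bad_covered.
  by apply: Pr_bad_fan; exact: ltW.
rewrite ler_wpM2r // card_powerset natrX.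
apply: (@le_trans _ _ (expR 1 ^+ #|G1|)).
  by apply: lerXn2r; rewrite ?nnegrE ?expR_ge0 //; have := @expR_ge1Dx R 1; lra.
by rewrite -expRM_natl mulr1 ler_expR.
Qed.

End SecondExposureProbability.

(** * Asymptotics *)

Section Asymptotics.
Local Open Scope classical_set_scope.
Variable R : realType.
Implicit Types u v : nat -> R.

(** One-sided, so that upper bounds can be chained without sign conditions; for probabilities it is
    convergence to 0. *)
Definition vanishing u := forall e : R, 0 < e -> \forall n \near \oo, u n <= e.
Definition diverging u := forall T : R, \forall n \near \oo, T <= u n.

Lemma vanishingD u v : vanishing u -> vanishing v -> vanishing (fun n => u n + v n).
Proof.
move=> hu hv e e0; have e2 : 0 < e / 2 by rewrite divr_gt0.
by apply: filterS2 (hu _ e2) (hv _ e2) => n; lra.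
Qed.

Lemma vanishingS u v : (\forall n \near \oo, u n <= v n) -> vanishing v -> vanishing u.
Proof. by move=> uv hv e e0; apply: filterS2 uv (hv e e0) => n; exact: le_trans. Qed.

Lemma vanishingZ u (c : R) : 0 < c -> vanishing u -> vanishing (fun n => c * u n).
Proof.
move=> c0 hu e e0; have ec : 0 < e / c by rewrite divr_gt0.
by apply: filterS (hu _ ec) => n; rewrite ler_pdivlMr // mulrC.
Qed.

Lemma vanishing_exp u : diverging u -> vanishing (fun n => expR (- u n)).
Proof.
move=> hu e e0; apply: filterS (hu (- ln e)) => n h.
by rewrite -[leRHS]lnK ?posrE // ler_expR; lra.
Qed.

(** Meant for the bound with a single factor [p]: its square depends on [p] only through p^2 = q /
    n. *)
Lemma vanishing_sqrt u : vanishing (fun n => u n ^+ 2) -> vanishing u.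
Proof.
move=> hu e e0; apply: filterS (hu (e ^+ 2) _) => [n h|]; last exact: exprn_gt0.
by rewrite leNgt; apply/negP => lt; move: h; rewrite leNgt ltr_pXn2r ?nnegrE ?lt // ltW //
  (lt_trans e0).
Qed.

Lemma divergingS u v : (\forall n \near \oo, u n <= v n) -> diverging u -> diverging v.
Proof. by move=> uv hu T; apply: filterS2 uv (hu T) => n h1 h2; exact: le_trans h2 h1. Qed.

Lemma divergingZ u (c : R) : 0 < c -> diverging u -> diverging (fun n => c * u n).
Proof.
move=> c0 hu T; apply: filterS (hu (T / c)) => n.
by rewrite ler_pdivrMr // mulrC.
Qed.

Lemma diverging_nat : diverging (fun n => n%:R).
Proof. by move=> T; exact: nbhs_infty_ger. Qed.

Lemma diverging_ln : diverging (fun n => ln n%:R).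
Proof.
move=> T; apply: filterS (diverging_nat (expR T)) => n h.
rewrite -[T]expRK ler_ln ?posrE ?expR_gt0 //.
exact: lt_le_trans (expR_gt0 T) h.
Qed.

(** expR t >= 1 + t at t = ln n / 2 gives n >= (ln n)^2 / 4. *)
Lemma diverging_linear_ln (M : R) : \forall n \near \oo, M * ln n%:R <= n%:R.
Proof.
apply: filterS3 (diverging_ln (4 * M)) (diverging_ln 0) (diverging_nat 1) => n h1 h2 n1.
apply: (@le_trans _ _ ((ln n%:R) ^+ 2 / 4)).
  have := mulr_ge0 h2 (_ : 0 <= ln n%:R - 4 * M); rewrite subr_ge0 => /(_ h1).
  by rewrite expr2; lra.
have e2 : expR (ln n%:R / 2) * expR (ln n%:R / 2) = n%:R :> R.
  by rewrite -expRD -splitr lnK // posrE; lra.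
have e1 := @expR_ge1Dx R (ln n%:R / 2).
have -> : ln n%:R ^+ 2 / 4 = (ln n%:R / 2) * (ln n%:R / 2) :> R by field.
by rewrite -[leRHS]e2; apply: ler_pM; lra.
Qed.

(** * Growth of n p^2 and n p *)

Section Rates.
Variables (C : R) (p : nat -> R).
Hypotheses (C32 : Num.sqrt (3 / 2) < C) (p01 : forall n, 0 <= p n <= 1)
  (hp : \forall n \near \oo, C * Num.sqrt (ln (n%:R : R) / n%:R) < p n).

Let q n : R := n%:R * p n ^+ 2.
Let d n : R := n%:R * p n.

Lemma C_gt0 : 0 < C.
Proof. by apply: le_lt_trans C32; rewrite sqrtr_ge0. Qed.

Lemma C2_gt : 3 / 2 < C ^+ 2.
Proof.
have h : 0 <= 3 / 2 :> R by lra.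
by rewrite -(sqr_sqrtr h) ltr_pXn2r // ?nnegrE ?sqrtr_ge0 // ltW // C_gt0.
Qed.

Lemma q_ge : \forall n \near \oo, C ^+ 2 * ln n%:R <= q n.
Proof.
apply: filterS3 hp (diverging_nat 1) (diverging_ln 0) => n hn n1 l0.
have n0 : 0 < n%:R :> R by lra.
have x0 : 0 <= ln n%:R / n%:R :> R by rewrite divr_ge0 // ltW.
have h : C ^+ 2 * (ln n%:R / n%:R) <= p n ^+ 2.
  rewrite -(sqr_sqrtr x0) -exprMn lerXn2r ?nnegrE ?mulr_ge0 ?sqrtr_ge0 ?(ltW C_gt0) ?(ltW hn) //.
  by have /andP[] := p01 n.
have -> : C ^+ 2 * ln n%:R = n%:R * (C ^+ 2 * (ln n%:R / n%:R)).
  by field; rewrite gt_eqF.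
by rewrite ler_wpM2l // ltW.
Qed.

Lemma q_ge32 : \forall n \near \oo, 3 / 2 * ln n%:R <= q n.
Proof.
apply: filterS2 q_ge (diverging_ln 0) => n h l0; apply: le_trans h.
by rewrite ler_wpM2r // ltW // C2_gt.
Qed.

Lemma diverging_q : diverging q.
Proof. by apply: divergingS q_ge32 (divergingZ _ diverging_ln); lra. Qed.

(** d^2 = n q, where q is at least ln n and n exceeds any multiple of ln n. *)
Lemma d_ge_ln (M : R) : \forall n \near \oo, M * ln n%:R <= d n.
Proof.
have M1 : 0 < `|M| + 1 by rewrite ltr_wpDl.
apply: filterS3 q_ge32 (diverging_linear_ln ((`|M| + 1) ^+ 2)) (diverging_ln 0) => n h1 h2 l0.
have d0 : 0 <= d n by rewrite mulr_ge0 //; have /andP[] := p01 n.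
apply: (@le_trans _ _ ((`|M| + 1) * ln n%:R)).
  by rewrite ler_wpM2r //; have := ler_norm M; lra.
rewrite -(@ler_pXn2r _ 2) ?nnegrE ?d0 ?mulr_ge0 ?(ltW M1) //.
rewrite exprMn (_ : d n ^+ 2 = n%:R * q n); last by rewrite /d /q; ring.
rewrite expr2 mulrA; apply: ler_pM => //; rewrite ?mulr_ge0 ?sqr_ge0 //.
by lra.
Qed.

Lemma diverging_d : diverging d.
Proof.
apply: divergingS (d_ge_ln 1) _; apply: divergingS diverging_ln.
by near=> n; rewrite mul1r.
Unshelve. all: by end_near. Qed.

Lemma diverging_nd : diverging (fun n => n%:R * d n).
Proof.
move=> T; apply: filterS3 (diverging_d (`|T|)) (diverging_nat 1) (diverging_d 0) => n h n1 d0.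
apply: (@le_trans _ _ (1 * d n)); first by rewrite mul1r (le_trans (ler_norm T)).
by rewrite ler_wpM2r.
Qed.

End Rates.
End Asymptotics.

(** * Sizes of W and X and the balance of exponents *)

Section NearCutBound.
Variables (R : realType) (n : nat) (p N : R).
Hypotheses (NE : N = n%:R) (n2 : (2 <= n)%N) (p01 : 0 <= p <= 1) (pp : 0 < p).

Lemma disjoint_sets_of_card w k : (w + k <= n)%N ->
  exists W X : {set 'I_n}, [/\ [disjoint W & X], #|W| = w & #|X| = k].
Proof.
move=> wk; pose e := enum 'I_n; have ue : uniq e := enum_uniq _.
have se : size e = n by rewrite size_enum_ord.
exists [set x in take w e], [set x in take k (drop w e)]; split.
- rewrite disjoints_subset; apply/subsetP => x; rewrite !inE => xw.
  apply/negP => /mem_take xd; move: ue; rewrite -(cat_take_drop w e) cat_uniq.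
  by move=> /and3P[_ /hasPn/(_ x xd)]; rewrite /= xw.
- rewrite cardsE (card_uniqP _) ?take_uniq // size_takel // se.
  by apply: leq_trans wk; exact: leq_addr.
- rewrite cardsE (card_uniqP _) ?take_uniq ?drop_uniq // size_takel // size_drop se.
  by rewrite leq_subRL ?(leq_trans (leq_addr k w)).
Qed.

Lemma near_half (x : R) : 2 <= x -> exists w : nat, x / 2 <= w%:R <= x.
Proof.
move=> x2; have x0 : 0 <= x by lra.
exists (Num.truncn x); have := truncn_itv x0; rewrite -natr1 => /andP[h1 h2].
by apply/andP; split => //; lra.
Qed.

Let D := N * (N * p).

(** [W] and [X] have sizes of order [ep * N] and [xi * N]. The rates [c2], for thin fans, and [c3],
    for missing covered pairs, are limited by [xi] and [dl] alone; [ep] is small against them, so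
    that expR (6 * ep * D) labellings are affordable. *)
Lemma near_cut_bound (al be xi ze ep dl c2 c3 : R) :
  0 < xi -> 0 < ze -> 0 < ep -> 0 < dl -> xi <= 1 / 2 -> ep <= xi ->
  12 * al + 24 * ep <= 2 * be -> ze + 4 * dl <= al -> ze <= xi * dl / 4 ->
  384 * c2 <= xi * dl -> 112 * (96 * c3) <= xi * dl ^+ 2 -> 6 * ep <= c2 -> 6 * ep <= c3 ->
  2 <= ep * N -> 2 * ln N <= c2 * (N * p) ->
  Pr p (edge_set n) (fun G => ~~ `[< near_cut G (2 * (be + 12 * xi) * D) >]) <=
  expR (- (3 * ep * D)) + (expR (- (ep / 2 * (N * p ^+ 2))) / ze +
  (N ^+ 2 * expR (- (4 * (N * p ^+ 2))) + (expR (- (3 * ep * D)) +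
  (N * expR (- (be / 2 * D)) + expR (- (c2 * D)) + expR (- (c3 * D)))))).
Proof.
move=> xi0 ze0 ep0 dl0 xi4 epxi be1 al1 ze1 c2E c3E ep1 ep2 epN lnN.
have N0 : 0 < N by rewrite NE ltr0n; exact: leq_trans n2.
have p0 : 0 <= p by exact: ltW.
have D0 : 0 < D by rewrite !mulr_gt0.
have [w /andP[w1 w2]] := near_half epN.
have [k /andP[k1 k2]] : exists k : nat, xi * N / 2 <= k%:R <= xi * N.
  by apply: near_half; apply: le_trans epN _; rewrite ler_pM2r.
have wk : (w + k <= n)%N.
  rewrite -(ler_nat R) natrD -NE.
  have : ep * N <= N / 2 by rewrite mulrC ler_pM2l //; move: epxi xi4; clear -NE n2 p01 pp D; lra.
  have : xi * N <= N / 2 by rewrite mulrC ler_pM2l //; move: xi4; clear -NE n2 p01 pp D; lra.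
  by move: w2 k2; clear -NE n2 p01 pp D; lra.
have [W [X [dWX cW cX]]] := disjoint_sets_of_card wk.
(* 224 = 8 * 4 * 7 gives [r * K = j * (p * s / 2) ^+ 2] with equality at [K = 7 * q]. *)
pose j := xi / 8 * N; pose s := dl * N; pose r := xi * dl ^+ 2 / 224 * N ^+ 2.
pose q := N * p ^+ 2.
have q0 : 0 < q by rewrite mulr_gt0 ?exprn_gt0.
have al0 : 0 < al by move: ze0 dl0 al1; clear -NE n2 p01 pp D; lra.
have key := @Pr_not_near_cut R n W X p s dWX p01 (ltW (mulr_gt0 dl0 N0)) j (7 * q) (al * N ^+ 2)
  (be * D) (dl * N) r (6 * (ep + xi) * D) (ze * N ^+ 2) (6 * ep * D).
apply: (@le_trans _ _ (Pr p (edge_set n) (fun G => ~~ `[< near_cut G (2 * (be * D + 6 * (ep + xi)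
  * D)) >]))).
  apply: Pr_mono => // G _; apply: contraNN => /asboolP nc; apply/asboolP => F sF cF.
  have [h hh] := nc F sF cF; exists h; apply: (le_trans hh).
  have : ep * D <= xi * D by rewrite ler_pM2r.
  by clear -NE n2 p01 pp D; lra.
apply: (le_trans (key _ _ _ _ _ _ _ _)) => {key}.
- by rewrite mulr_gt0 ?exprn_gt0.
- by rewrite mulr_ge0 ?sqr_ge0 // ltW.
- by rewrite mulr_gt0.
- by rewrite mulr_gt0.
- by rewrite !mulr_gt0.
- apply: (@le_trans _ _ (xi * N / 4 * (dl * N))).
    rewrite expr2 [leRHS](_ : _ = xi * dl / 4 * (N * N)); last by field.
    by rewrite ler_pM2r ?mulr_gt0.
  by rewrite ler_pM2r ?mulr_gt0 // cX /j; move: k1; clear -NE n2 p01 pp D; lra.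
- rewrite -NE /s [leLHS](_ : _ = (ze + 4 * dl) * N ^+ 2); last by ring.
  by rewrite ler_pM2r ?exprn_gt0.
- by rewrite le_eqVlt; apply/orP; left; apply/eqP; rewrite /r /q /j /s; field.
have cT (U : {set 'I_n}) (m : R) : (#|U|%:R : R) <= m * N ->
    Pr p (edge_set n) (fun G => 6 * m * D <= #|G :&: touch U|%:R) <= expR (- (3 * m * D)).
  move=> Um; apply: (le_trans (upper_tail p01 _ (touch_sub U))); rewrite ler_expR.
  have : (#|touch U|%:R : R) <= #|U|%:R * N by rewrite NE -natrM ler_nat card_touch.
  have : #|U|%:R * N <= m * N * N by rewrite ler_pM2r.
  move=> h1 h2; have := ler_wpM2l p0 (le_trans h2 h1).
  by rewrite /D; clear -NE n2 p01 pp D; lra.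
apply: lerD.
  apply: (le_trans (cT _ _ _)).
    apply: (@le_trans _ _ (w%:R + k%:R)); last by rewrite mulrDl lerD.
    by rewrite -natrD ler_nat -cW -cX leq_card_setU.
  by rewrite ler_expR lerN2; have := mulr_gt0 xi0 D0; clear -NE n2 p01 pp D; lra.
apply: lerD.
  apply: (le_trans (Pr_uncovered W p01 _)); first by rewrite mulr_gt0 ?exprn_gt0.
  rewrite -NE invfM [leLHS](_ : _ = expR (- (p ^+ 2 * #|W|%:R)) / ze); last first.
    by field; rewrite !gt_eqF.
  rewrite ler_pM2r ?invr_gt0 // ler_expR lerN2 cW.
  by have := ler_wpM2l (sqr_ge0 p) w1; clear -NE n2 p01 pp D; lra.
apply: lerD; first exact: Pr_large_codegree.
apply: lerD; first by apply: cT; rewrite cW.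
rewrite mulrDr mulrDr; apply: lerD; first apply: lerD.
- rewrite -NE mulrCA ler_pM2l // -expRD ler_expR.
  rewrite [leLHS](_ : _ = (6 * ep + 3 * al - be) * D); last by rewrite /D; ring.
  by rewrite -mulNr ler_pM2r //; move: be1; clear -NE n2 p01 pp D; lra.
- have -> : n.+2%:R ^+ n = expR (N * ln n.+2%:R) :> R.
    by rewrite NE expRM_natl lnK // posrE ltr0n.
  rewrite -!expRD ler_expR.
  have l2 : ln n.+2%:R <= 2 * ln N.
    rewrite mulr_natl -lnXn // ler_ln ?posrE ?exprn_gt0 ?ltr0n //.
    rewrite NE -natrX ler_nat -mulnn; apply: (@leq_trans (n * 2)).
      by rewrite muln2 -addnn -addn2 leq_add2l.
    by rewrite leq_mul2l n2 orbT.
  have l3 : N * ln n.+2%:R <= c2 * D.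
    rewrite [leRHS](_ : _ = N * (c2 * (N * p))); last by rewrite /D; ring.
    by rewrite ler_pM2l //; exact: le_trans l2 lnN.
  have l4 : 6 * ep * D <= c2 * D by rewrite ler_pM2r.
  have l5 : 384 * c2 * D <= xi * dl * D by rewrite ler_pM2r.
  (* This rate is at least [4 * c2 * D]; the choices of a fan and the labellings cost at most
     [c2 * D] each. *)
  have -> : p * (j * s) / 12 = xi * dl / 96 * D by rewrite /j /s /D; field.
  have l6 : 0 < ep * D by rewrite mulr_gt0.
  by move: l3 l4 l5 l6; clear -NE n2 p01 pp D; lra.
- rewrite -expRD ler_expR.
  have -> : p * r / 24 = xi * dl ^+ 2 * D / 224 / 24 by rewrite /r /D; field.
  have : 6 * ep * D <= c3 * D by rewrite ler_pM2r.
  have : 112 * (96 * c3) * D <= xi * dl ^+ 2 * D by rewrite ler_pM2r.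
  by clear -NE n2 p01 pp D; lra.
Qed.

End NearCutBound.

(** * Union bound over all failures *)

Section SpanBound.
Variables (R : realType) (n : nat) (p N : R).
Hypotheses (NE : N = n%:R) (n4 : (4 <= n)%N) (p01 : 0 <= p <= 1) (pp : 0 < p).
Local Notation d := (N * p).
Local Notation q := (N * p ^+ 2).

(** [Pr_dense_set] serves twice: with [M = q] its size condition reads [#|A| <= theta * d], with
    [M = d] and [sigma] for [theta] it reads [#|A| <= sigma * n]. The numbers 28 and 7 are [4 * K]
    and [K] for [K = 7]. *)
Lemma triangle_space_bound (eta l tau1 tau2 theta sigma l1 l2 g : R) :
  0 <= l -> 0 < eta -> 0 < theta -> 0 < sigma -> 0 < tau1 -> 0 < tau2 -> 0 <= l1 -> 0 <= l2 ->
  9 <= l1 * tau1 -> theta * expR l1 <= 1 -> 9 <= l2 * tau2 -> sigma * expR l2 <= 1 ->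
  4 * tau1 <= eta -> 28 * tau1 * theta + 7 * tau2 * eta < theta * eta / 16 ->
  g <= theta * sigma ->
  N * expR (- (4 * q)) <= 1 / 2 -> N * expR (- (4 * d)) <= 1 / 2 ->
  Pr p (edge_set n) (fun G => ~~ triangle_space_eq_cycle_space G) <=
  N * expR (- (d / 16)) + (N ^+ 2 * expR (- (4 * q)) +
  (N ^+ 2 * (p * expR (l * eta * q - (1 - expR (- l)) * (N - 2) * p ^+ 2)) +
  (2 * (N * expR (- (4 * q))) + (2 * (N * expR (- (4 * d))) +
  (N * (expR d * expR (- (theta * q * d / 96))) +
   Pr p (edge_set n) (fun G => ~~ `[< near_cut G (g * (N * d)) >])))))).
Proof.
move=> l0 eta0 th0 si0 t10 t20 l10 l20 lt1 tl1 lt2 tl2 t1e consts gts hq hd.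
have N0 : 0 < N by rewrite NE ltr0n; exact: leq_trans n4.
have d0 : 0 < d by rewrite mulr_gt0.
have q0 : 0 < q by rewrite mulr_gt0 ?exprn_gt0.
have h1 := Pr_small_degree NE n4 p01.
have h2 := Pr_large_codegree NE p01.
have h3 := Pr_small_codegree NE n4 p01 eta l0.
have h4 := Pr_dense_set NE p01 (ltW q0) l10 lt1 tl1 (ltW th0) hq.
have h5 := Pr_dense_set NE p01 (ltW d0) l20 lt2 tl2 (ltW si0) hd.
have h6 := Pr_bad_link NE n4 p01 (ltW th0).
pose P7 (G : {set {set 'I_n}}) := ~~ `[< near_cut G (g * (N * d)) >].
pose P1 (G : {set {set 'I_n}}) := [exists v, #|nbr G v|%:R <= d / 4].
pose P2 (G : {set {set 'I_n}}) :=
  [exists u : 'I_n * 'I_n, (u.1 != u.2) && (7 * q <= (codeg G u.1 u.2)%:R)].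
pose P3 (G : {set {set 'I_n}}) := [exists u : 'I_n * 'I_n,
  (u.1 != u.2) && (([set u.1; u.2] \in G) && ((codeg G u.1 u.2)%:R <= eta * q))].
pose P45 (t th M : R) (G : {set {set 'I_n}}) := [exists A : {set 'I_n},
  (p * #|A|%:R <= th * M) && (t * #|A|%:R * M < (edges_between G A A)%:R)].
pose P6 (G : {set {set 'I_n}}) := [exists v, [exists A : {set 'I_n},
  [&& A \subset nbr G v, theta * d <= #|A|%:R,
     (#|A|.*2 <= #|nbr G v|)%N, d / 4 <= #|nbr G v|%:R &
     (edges_between G A (nbr G v :\: A))%:R <= q * #|A|%:R / 16]]].
apply: (le_trans (y := Pr p (edge_set n) (fun G => P1 G || (P2 G || (P3 G ||
   (P45 tau1 theta q G || (P45 tau2 sigma d G || (P6 G || P7 G)))))))); last first.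
  apply: (le_trans (PrU p01 _ _ _)); apply: lerD => //.
  apply: (le_trans (PrU p01 _ _ _)); apply: lerD => //.
  apply: (le_trans (PrU p01 _ _ _)); apply: lerD => //.
  apply: (le_trans (PrU p01 _ _ _)); apply: lerD => //.
  apply: (le_trans (PrU p01 _ _ _)); apply: lerD => //.
  by apply: (le_trans (PrU p01 _ _ _)); apply: lerD.
apply: Pr_mono => // G sG; apply: contraR; rewrite !negb_or => /and5P[e1 e2 e3 e4 /and3P[e5 e6]].
rewrite negbK => /asboolP nc.
apply: triangle_space_cocycles => // F sF cF.
apply: (@regular_coboundary _ _ G F 7 eta (1/16) tau1 tau2 theta sigma q d) => //; last first.
- have [h hh] := nc F sF cF; exists h; apply: (le_trans hh).
  by rewrite -NE -[leRHS](mulrA (theta * sigma)) ler_pM2r // mulr_gt0.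
- lra.
split.
- move=> x y xy; rewrite leNgt; apply: contraNN e3 => lt.
  by apply/existsP; exists (x, y); rewrite /= (edge_neq sG xy) xy ltW.
- move=> x y xy; rewrite leNgt; apply: contraNN e2 => lt.
  by apply/existsP; exists (x, y); rewrite /= xy ltW.
- move=> A hA; rewrite leNgt; apply: contraNN e4 => lt.
  apply/existsP; exists A; rewrite lt andbT.
  by rewrite [leRHS](_ : _ = p * (theta * d)) ?ler_pM2l //; ring.
- move=> v A sA hA hA2; rewrite leNgt; apply: contraNN e6 => lt.
  apply/existsP; exists v; apply/existsP; exists A; rewrite sA hA hA2 /=.
  apply/andP; split; last by apply: ltW; apply: lt_le_trans lt _; lra.
  rewrite leNgt; apply: contraNN e1 => lt'.
  by apply/existsP; exists v; exact: ltW.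
- move=> A hA; rewrite leNgt; apply: contraNN e5 => lt.
  apply/existsP; exists A; rewrite lt andbT.
  by rewrite [leRHS](_ : _ = p * (sigma * N)) ?ler_pM2l ?NE //; ring.
Qed.

End SpanBound.

(** * Choice of the constants and conclusion *)

Section Main.
Variables (R : realType) (C : R) (p : nat -> R).
Hypotheses (C32 : Num.sqrt (3 / 2) < C) (p01 : forall n, 0 <= p n <= 1)
  (hp : (\forall n \near (\oo)%classic, C * Num.sqrt (ln (n%:R : R) / n%:R) < p n)%classic).

Let q n : R := n%:R * p n ^+ 2.
Let d n : R := n%:R * p n.

Lemma vanishing_poly_exp (k : nat) (u : nat -> R) :
  (\forall n \near (\oo)%classic, k.+1%:R * ln n%:R <= u n)%classic ->
  vanishing (fun n => n%:R ^+ k * expR (- u n)).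
Proof.
move=> hu; apply: vanishingS (vanishing_exp (@diverging_ln R)).
apply: filterS2 hu (diverging_nat (1 : R)) => n hn n1.
have e : n%:R = expR (ln n%:R) :> R by rewrite lnK // posrE; lra.
rewrite {1}e -expRM_natl -expRD ler_expR; move: hn; rewrite -natr1; lra.
Qed.

Let hq := q_ge32 C32 p01 hp.

Lemma lower_bound2 (a b : R) : 0 < a -> 0 < b -> exists c : R, [/\ 0 < c, c <= a & c <= b].
Proof.
move=> a0 b0; exists (Num.min a b).
by split; rewrite ?lt_min ?a0 // ge_min lexx ?orbT.
Qed.

(** [be], [al], [dl], [xi] and [ze] are fixed from [g], then the rates [c2] and [c3], and [ep] last,
    below all of these requirements. The resulting distance 2 (be + 12 xi) is at most 3 g / 4. *)
Lemma vanishing_near_cut (g : R) : 0 < g ->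
  vanishing (fun n => Pr (p n) (edge_set n) (fun G => ~~ `[< near_cut G (g * (n%:R * d n)) >])).
Proof.
move=> g0.
have [be be1] : exists be : R, be = g / 4 by exists (g / 4).
have be0 : 0 < be by rewrite be1 divr_gt0.
have [al al1] : exists al : R, al = be / 12 by exists (be / 12).
have al0 : 0 < al by rewrite al1 divr_gt0.
have [dl dl1] : exists dl : R, dl = al / 8 by exists (al / 8).
have dl0 : 0 < dl by rewrite dl1 divr_gt0.
have [xi [xi0 xi1 xi2]] := lower_bound2 (divr_gt0 g0 (ltr0n R 96)) (divr_gt0 ltr01 (ltr0n R 2)).
have xd0 : 0 < xi * dl by rewrite mulr_gt0.
have xdd0 : 0 < xi * dl ^+ 2 by rewrite mulr_gt0 ?exprn_gt0.
have [ze [ze0 ze1 ze2]] := lower_bound2 (divr_gt0 al0 (ltr0n R 4)) (divr_gt0 xd0 (ltr0n R 4)).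
have [ep' [ep'0 ep1' ep2']] := lower_bound2 xi0 (divr_gt0 be0 (ltr0n R 24)).
have [c2 [c20 c2E _]] := lower_bound2 (divr_gt0 xd0 (ltr0n R 384)) ltr01.
have [c3 [c30 c3E _]] :=
  lower_bound2 (divr_gt0 (divr_gt0 xdd0 (ltr0n R 112)) (ltr0n R 96)) ltr01.
have [ep'' [ep''0 ep3'' ep4'']] :=
  lower_bound2 (divr_gt0 c20 (ltr0n R 6)) (divr_gt0 c30 (ltr0n R 6)).
have [ep [ep0 epl epr]] := lower_bound2 ep'0 ep''0.
have ep1 := le_trans epl ep1'; have ep2 := le_trans epl ep2'.
have ep3 := le_trans epr ep3''; have ep4 := le_trans epr ep4''.
clear ep' ep'' ep'0 ep''0 ep1' ep2' ep3'' ep4'' epl epr.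
have div (c : R) : 0 < c -> diverging (fun n => c * (n%:R * (n%:R * p n))).
  by move=> c0; apply: divergingZ => //; exact: diverging_nd C32 p01 hp.
set bnd := fun n : nat => expR (- (3 * ep * (n%:R * (n%:R * p n)))) +
  (expR (- (ep / 2 * (n%:R * p n ^+ 2))) / ze +
  (n%:R ^+ 2 * expR (- (4 * (n%:R * p n ^+ 2))) + (expR (- (3 * ep * (n%:R * (n%:R * p n)))) +
  (n%:R * expR (- (be / 2 * (n%:R * (n%:R * p n)))) + expR (- (c2 * (n%:R * (n%:R * p n)))) +
   expR (- (c3 * (n%:R * (n%:R * p n)))))))) : R.
apply: (@vanishingS _ _ bnd); last first.
  apply: vanishingD; first by apply/vanishing_exp/div; rewrite mulr_gt0.
  apply: vanishingD.
    apply: (@vanishingS _ _ (fun n => ze^-1 * expR (- (ep / 2 * (n%:R * p n ^+ 2))))).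
      by apply: nearW => n; rewrite mulrC.
    apply: vanishingZ; first by rewrite invr_gt0.
    apply: vanishing_exp; apply: divergingZ; first by rewrite divr_gt0.
    exact: diverging_q C32 p01 hp.
  apply: vanishingD.
    apply: vanishing_poly_exp; apply: filterS2 hq (diverging_ln (0 : R)) => n h1 h2.
    by move: h1 h2; rewrite /q; clear -C32 p01 hp q d hq; lra.
  apply: vanishingD; first by apply/vanishing_exp/div; rewrite mulr_gt0.
  apply: vanishingD; last exact/vanishing_exp/div.
  apply: vanishingD; last exact/vanishing_exp/div.
  apply: (@vanishing_poly_exp 1).
  apply: filterS3 (d_ge_ln C32 p01 hp (4 / be)) (diverging_nat (1 : R)) (diverging_ln (0 : R)) =>
    n h1 h2 h3.
  have b2 : 2 * ln n%:R <= be / 2 * (n%:R * p n).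
    have := ler_wpM2l (ltW be0) h1.
    have -> : be * (4 / be * ln n%:R) = 4 * ln n%:R by field; rewrite gt_eqF.
    by clear -C32 p01 hp q d hq; lra.
  apply: (le_trans b2); rewrite ler_pM2l; last by rewrite divr_gt0.
  have dn0 : 0 <= n%:R * p n :> R by rewrite mulr_ge0 //; have /andP[] := p01 n.
  by apply: ler_peMl; [exact: dn0|exact: h2].
have f1 := d_ge_ln C32 p01 hp (2 / c2).
have f2 := diverging_nat (2 / ep).
have f3 := diverging_d C32 p01 hp 1.
have f4 := diverging_nat (2 : R).
apply: filterS3 f1 f2 (filterI f3 f4) => n g1 g2 [g3 g4].
have n2 : (2 <= n)%N by rewrite -(ler_nat R).
have pp : 0 < p n.
  have /andP[pn _] := p01 n; rewrite lt_def pn andbT; apply: contraTneq g3 => ->.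
  by rewrite mulr0 -ltNge.
apply: (le_trans (y := Pr (p n) (edge_set n)
   (fun G => ~~ `[< near_cut G (2 * (be + 12 * xi) * (n%:R * (n%:R * p n))) >]))).
  apply: Pr_mono => // G _; apply: contraNN => /asboolP nc; apply/asboolP => F sF cF.
  have [h hh] := nc F sF cF; exists h; apply: (le_trans hh).
  apply: ler_wpM2r; first by rewrite !mulr_ge0 // ltW.
  by lra.
apply: (@near_cut_bound R n (p n) n%:R erefl n2 (p01 n) pp al be xi ze ep dl c2 c3) => //.
- by move: al0 al1 ep2; clear -C32 p01 hp q d hq; lra.
- by move: al0 dl1 ze1; clear -C32 p01 hp q d hq; lra.
- by move: c2E; clear -C32 p01 hp q d hq; lra.
- by move: c3E; clear -C32 p01 hp q d hq; lra.
- by move: ep3; clear -C32 p01 hp q d hq; lra.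
- by move: ep4; clear -C32 p01 hp q d hq; lra.
- by move: g2; rewrite ler_pdivrMr // mulrC.
- have := ler_wpM2l (ltW c20) g1.
  by have -> : c2 * (2 / c2 * ln n%:R) = 2 * ln n%:R by field; rewrite gt_eqF.
Qed.

(** The place where C^2 > 3/2 is decisive. The squared bound is n^3 Q expR (2 x) with Q = n p^2 and
    x at most 2 - (1 - rho) Q. As Q <= expR (2 rho Q) / (2 rho), the exponent becomes 4 + 3 ln n - 2
    (1 - 2 rho) Q, at most 4 - (C^2 - 3/2) ln n. *)
Lemma vanishing_small_codegree (rho l eta : R) : 0 < rho -> rho <= 1 / 4 ->
  3 + (C ^+ 2 - 3 / 2) <= 2 * (1 - 2 * rho) * C ^+ 2 ->
  expR (- l) <= rho / 2 -> l * eta <= rho / 2 ->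
  vanishing (fun n => n%:R ^+ 2 * (p n *
    expR (l * eta * (n%:R * p n ^+ 2) - (1 - expR (- l)) * (n%:R - 2) * p n ^+ 2))).
Proof.
move=> rho0 rho4 Crho ler letr; apply: vanishing_sqrt.
have C0 : 0 < C ^+ 2 - 3 / 2 by rewrite subr_gt0; exact: C2_gt.
apply: (@vanishingS _ _ (fun n => expR 4 / (2 * rho) * expR (- ((C ^+ 2 - 3 / 2) * ln n%:R))));
  last first.
  apply: vanishingZ; first by rewrite divr_gt0 ?expR_gt0 ?mulr_gt0.
  by apply: vanishing_exp; apply: divergingZ C0 (@diverging_ln R).
apply: filterS3 (q_ge C32 p01 hp) (diverging_nat (2 : R)) (diverging_ln (0 : R)) => n qC n2 l0.
have n0 : 0 < n%:R :> R by apply: lt_le_trans n2.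
have /andP[p0 p1] := p01 n.
have p2 : p n ^+ 2 <= 1 by rewrite expr_le1.
have p20 : 0 <= p n ^+ 2 by exact: sqr_ge0.
set Q := n%:R * p n ^+ 2 in qC *.
have Q0 : 0 <= Q by rewrite mulr_ge0 // ltW.
set x := _ - _ * p n ^+ 2.
(* The summand 2 pays for n - 2 in place of n, as p^2 <= 1. *)
have x_le : x <= 2 - (1 - rho) * Q.
  have h1 : l * eta * Q <= rho / 2 * Q by rewrite ler_wpM2r.
  have h2 : expR (- l) * ((n%:R - 2) * p n ^+ 2) <= rho / 2 * ((n%:R - 2) * p n ^+ 2).
    by rewrite ler_wpM2r // mulr_ge0 // subr_ge0.
  have h3 : 0 <= rho * p n ^+ 2 by rewrite mulr_ge0 // ltW.
  rewrite /x; move: h1 h2 h3 p2; rewrite /Q; clear -C32 p01 hp q d hq; lra.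
rewrite (_ : (_ * _) ^+ 2 = n%:R ^+ 3 * Q * expR (2 * x)); last first.
  by rewrite (expRM_natl 2 x) /Q; ring.
have QE : Q <= expR (2 * rho * Q) / (2 * rho).
  rewrite ler_pdivlMr ?mulr_gt0 // mulrC.
  by have := expR_ge1Dx (2 * rho * Q); lra.
apply: (@le_trans _ _ (n%:R ^+ 3 * (expR (2 * rho * Q) / (2 * rho)) * expR (2 * x))).
  by rewrite ler_wpM2r ?expR_ge0 // ler_wpM2l // exprn_ge0 // ltW.
rewrite [leLHS](_ : _ = n%:R ^+ 3 * expR (2 * rho * Q) * expR (2 * x) / (2 * rho)); last first.
  by field; rewrite gt_eqF.
rewrite [leRHS](_ : _ = expR 4 * expR (- ((C ^+ 2 - 3 / 2) * ln n%:R)) / (2 * rho)); last first.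
  by field; rewrite gt_eqF.
rewrite ler_pM2r ?invr_gt0 ?mulr_gt0 //.
have -> : n%:R ^+ 3 = expR (3 * ln n%:R) :> R.
  by rewrite (expRM_natl 3) lnK // posrE.
rewrite -!expRD ler_expR.
have : 2 * (1 - 2 * rho) * (C ^+ 2 * ln n%:R) <= 2 * (1 - 2 * rho) * Q.
  by rewrite ler_wpM2l //; lra.
have := ler_wpM2r l0 Crho; move: x_le; clear -C32 p01 hp q d hq; lra.
Qed.

Lemma vanishing_no_span :
  vanishing (fun n => Pr (p n) (edge_set n) (fun G => ~~ triangle_space_eq_cycle_space G)).
Proof.
have C0 : 0 < C ^+ 2 - 3 / 2 by rewrite subr_gt0; exact: C2_gt.
have C2 : 0 < C ^+ 2 by lra.
have [rho [rho0 rho4 Crho]] : exists rho, [/\ 0 < rho, rho <= 1 / 4 &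
    3 + (C ^+ 2 - 3 / 2) <= 2 * (1 - 2 * rho) * C ^+ 2].
  have C4 : 0 < 4 * C ^+ 2 by rewrite mulr_gt0.
  (* This value turns the third condition into an equality: 2 (1 - 2 rho) C^2 = C^2 + 3/2. *)
  exists ((C ^+ 2 - 3 / 2) / (4 * C ^+ 2)); split; first by rewrite divr_gt0.
    by rewrite ler_pdivrMr //; lra.
  have : (C ^+ 2 - 3 / 2) / (4 * C ^+ 2) * (4 * C ^+ 2) = C ^+ 2 - 3 / 2.
    by rewrite divfK // gt_eqF.
  by move: (_ / (4 * _)) => rho; clear -C32 p01 hp q d hq; lra.
have [l lE] : exists l : R, l = 2 / rho by exists (2 / rho).
have l0 : 0 < l by rewrite lE divr_gt0.
have [eta etaE] : exists eta : R, eta = rho / (2 * l) by exists (rho / (2 * l)).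
have eta0 : 0 < eta by rewrite etaE divr_gt0 // mulr_gt0.
have l_exp : expR (- l) <= rho / 2.
  have -> : rho / 2 = l^-1 by rewrite lE invf_div.
  rewrite expRN lef_pV2 ?posrE ?expR_gt0 //.
  by apply: le_trans (expR_ge1Dx l); rewrite lerDr ler01.
have l_eta : l * eta <= rho / 2.
  by rewrite etaE (_ : l * _ = rho / 2) //; field; rewrite gt_eqF.
have rate (tau : R) : 0 < tau -> exists m : R, [/\ 0 < m, 9 <= m * tau & 0 < expR (- m)].
  move=> tau0; exists (9 / tau); split; [by rewrite divr_gt0| |exact: expR_gt0].
  by rewrite divfK // gt_eqF.
(* The divisor 600, used for [tau1] and [tau2], satisfies [consts] because (28 + 7) / 600 < 1/16. *)
have [tau1 t1E] : exists tau1 : R, tau1 = eta / 600 by exists (eta / 600).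
have t10 : 0 < tau1 by rewrite t1E; exact: divr_gt0 eta0 (ltr0n R 600).
have [l1 [l10 lt1 th0]] := rate _ t10; set theta := expR (- l1) in th0.
have tl1 : theta * expR l1 <= 1 by rewrite -expRD addNr expR0.
have [tau2 t2E] : exists tau2 : R, tau2 = theta / 600 by exists (theta / 600).
have t20 : 0 < tau2 by rewrite t2E; exact: divr_gt0 th0 (ltr0n R 600).
have [l2 [l20 lt2 si0]] := rate _ t20; set sigma := expR (- l2) in si0.
have tl2 : sigma * expR l2 <= 1 by rewrite -expRD addNr expR0.
have t1e : 4 * tau1 <= eta by move: eta0 t1E; clear -C32 p01 hp q d hq; lra.
have consts : 28 * tau1 * theta + 7 * tau2 * eta < theta * eta / 16.
  have := mulr_gt0 th0 eta0; rewrite t1E t2E; move: (theta) => th.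
  by clear -C32 p01 hp q d hq; lra.
have g0 : 0 < theta * sigma by rewrite mulr_gt0.
have vq : vanishing (fun n : nat => n%:R * expR (- (4 * (n%:R * p n ^+ 2)))).
  apply: (@vanishing_poly_exp 1); apply: filterS2 hq (diverging_ln (0 : R)) => n h1 h2.
  by move: h1 h2; rewrite /q; clear -C32 p01 hp q d hq; lra.
have vd : vanishing (fun n : nat => n%:R * expR (- (4 * (n%:R * p n)))).
  apply: (@vanishing_poly_exp 1); apply: filterS2 (d_ge_ln C32 p01 hp 1) (diverging_ln (0 : R))
    => n h1 h2.
  by move: h1 h2; clear -C32 p01 hp q d hq; lra.
have half : 0 < 1 / 2 :> R by rewrite divr_gt0.
apply: vanishingS (_ : vanishing (fun n => n%:R * expR (- (n%:R * p n / 16)) +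
  (n%:R ^+ 2 * expR (- (4 * (n%:R * p n ^+ 2))) +
  (n%:R ^+ 2 * (p n * expR (l * eta * (n%:R * p n ^+ 2) - (1 - expR (- l)) * (n%:R - 2) * p n ^+
    2)) +
  (2 * (n%:R * expR (- (4 * (n%:R * p n ^+ 2)))) + (2 * (n%:R * expR (- (4 * (n%:R * p n)))) +
  (n%:R * (expR (n%:R * p n) * expR (- (theta * (n%:R * p n ^+ 2) * (n%:R * p n) / 96))) +
   Pr (p n) (edge_set n) (fun G => ~~ `[< near_cut G (theta * sigma * (n%:R * (n%:R * p n)))
     >])))))))).
  apply: filterS3 (vq _ half) (vd _ half) (filterI (diverging_nat (4 : R)) (diverging_d C32 p01
    hp 1)).
  move=> n vqn vdn [n4 d1].
  have pp : 0 < p n.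
    have /andP[pn _] := p01 n; rewrite lt_def pn andbT; apply: contraTneq d1 => ->.
    by rewrite mulr0 -ltNge.
  have n4' : (4 <= n)%N by rewrite -(ler_nat R).
  exact: (triangle_space_bound erefl n4' (p01 n) pp (ltW l0) eta0 th0 si0 t10 t20
    (ltW l10) (ltW l20) lt1 tl1 lt2 tl2 t1e consts (lexx _) vqn vdn).
apply: vanishingD.
  apply: (@vanishing_poly_exp 1); apply: filterS2 (d_ge_ln C32 p01 hp 32) (diverging_ln (0 : R))
    => n h1 h2.
  by move: h1 h2; clear -C32 p01 hp q d hq; lra.
apply: vanishingD.
  apply: vanishing_poly_exp; apply: filterS2 hq (diverging_ln (0 : R)) => n h1 h2.
  by move: h1 h2; rewrite /q; clear -C32 p01 hp q d hq; lra.
apply: vanishingD; first exact: (@vanishing_small_codegree rho).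
apply: vanishingD; first exact: vanishingZ.
apply: vanishingD; first exact: vanishingZ.
apply: vanishingD; last exact: vanishing_near_cut.
apply: (@vanishingS _ _ (fun n => n%:R ^+ 1 * expR (- (theta * (n%:R * p n ^+ 2) * (n%:R * p n) /
  96 - n%:R * p n)))).
  by apply: nearW => n; rewrite -expRD expr1 opprB.
apply: vanishing_poly_exp.
(* Eventually theta q / 96 >= 3, so that after paying [expR d] for the subsets a rate of at least 2
   d >= 2 ln n remains. *)
apply: filterS3 (diverging_q C32 p01 hp (96 * 3 / theta)) (d_ge_ln C32 p01 hp 1) (diverging_ln (0
  : R)) => n h1 h2 h3.
have dn0 : 0 <= n%:R * p n by rewrite mulr_ge0 //; have /andP[] := p01 n.
have := ler_wpM2r dn0 (ler_wpM2l (ltW th0) h1).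
have -> : theta * (96 * 3 / theta) = 96 * 3 by field; rewrite gt_eqF.
by move: h2 h3; clear -C32 p01 hp q d hq; lra.
Qed.

End Main.

Lemma Gnp_probE (R : realType) (n : nat) (p : R) (P : pred {set {set 'I_n}}) :
  Gnp_prob p P = Pr p (edge_set n) P.
Proof.
rewrite /Gnp_prob /Pr /Ex big_mkcondr; apply: eq_bigr => G _.
by case: (P G); rewrite ?mulr1 ?mulr0.
Qed.

Local Open Scope classical_set_scope.

Theorem theorem1p2 (R : realType) (C : R) (p : nat -> R) :
  Num.sqrt (3 / 2) < C ->
  (forall n, 0 <= p n <= 1) ->
  (\forall n \near \oo, C * Num.sqrt (ln (n%:R : R) / n%:R) < p n) ->
  (fun n : nat => Gnp_prob (p n) (@triangle_space_eq_cycle_space n)) @ \oo --> (1 : R).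
Proof.
move=> C32 p01 hp; apply/cvgrPdist_le => e e0.
apply: filterS (vanishing_no_span C32 p01 hp e0) => n hn.
rewrite Gnp_probE PrC opprB addrC subrK ger0_norm //.
exact: Pr_ge0 (p01 n) _ _.
Qed.
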